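(* Let $\mu>0$, $T>0$, $c\ge 0$, $\delta>0$, and let $\rho_0,\rho_1<1$ satisfy $1-\rho_1=(1+\delta)(1-\rho_0)$ and $\rho_1>0$. Let $g\ge 0$ be a kernel shape with $\int_0^\infty g=1$. For $j\in\{0,1\}$ let $P_j^T$ be the law of the restriction to $[0,T]$ of the linear Hawkes process with baseline $\mu$, branching ratio $\rho_j$ and kernel shape $g$, started empty at time $s_0=-cT$. Then $$\mathrm{KL}\big(P_0^T\,\|\,P_1^T\big)\le \frac{\delta^2(1+c)}{\rho_0\rho_1}\,\mathcal I_T,\qquad \mathcal I_T=T\mu(1-\rho_0).$$
   Context: A linear Hawkes process with baseline $\mu>0$, branching ratio $\rho\in(0,1)$ and normalised kernel shape $g\ge0$, $\int_0^\infty g=1$, started empty at time $s_0\le 0$, is a simple point process $N$ on $(s_0,\infty)$ (with no points at or before $s_0$) having stochastic intensity $\lambda(t)=\mu+\rho\int_{(s_0,t)}g(t-s)\,N(\mathrm ds)$ with respect to its natural filtration. $\mathrm{KL}(P\|Q)=\mathbb E_P\log(\mathrm dP/\mathrm dQ)$ denotes the Kullback--Leibler divergence. *)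

(* Defs.v *)
From HB Require Import structures.
From mathcomp Require Import all_boot all_order all_algebra.
From mathcomp Require Import all_classical all_reals all_analysis.
From mathcomp Require Import measurable_realfun.

Set Implicit Arguments.
Unset Strict Implicit.
Unset Printing Implicit Defensive.

Import Order.TTheory GRing.Theory Num.Theory.
Import numFieldNormedType.Exports.

Local Open Scope classical_set_scope.
Local Open Scope ring_scope.
Local Open Scope ereal_scope.

(* [P `<< Q] fails exactly when dP/dQ does not exist; the divergence is then
   +oo by convention.  The negative part of log(dP/dQ) is P-integrable, so the
   integral is never an indeterminate difference. *)
Definition KL d (T : measurableType d) (R : realType) (P Q : probability T R)
    : \bar R :=
  if `[< P `<< Q >] then
    \int[P]_x lne (Radon_Nikodym (charge_of_finite_measure P) Q x)
  else +oo.

Section measure_space.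
Context d (T : measurableType d) (R : realType).

Definition measures : Type := {measure set T -> \bar R}.

HB.instance Definition _ := gen_eqMixin measures.
HB.instance Definition _ := gen_choiceMixin measures.
HB.instance Definition _ := isPointed.Build measures mzero.

Definition evaluation (m : measures) (B : set T) : \bar R := m B.

Definition evaluation_sets : set_system measures :=
  \bigcup_(B in measurable)
    preimage_set_system [set: measures] (evaluation ^~ B) measurable.

Definition measures_measurable : set_system measures := <<s evaluation_sets >>.

Let measures_measurable0 : measures_measurable set0.
Proof. exact: sigma_algebra0. Qed.

Let measures_measurableC (U : set measures) :
  measures_measurable U -> measures_measurable (~` U).
Proof. exact: sigma_algebraC. Qed.

Let measures_measurableU (F : (set measures)^nat) :
  (forall i, measures_measurable (F i)) ->
  measures_measurable (\bigcup_i F i).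
Proof. exact: sigma_algebra_bigcup. Qed.

Definition measures_display : measure_display.
Proof. by constructor. Qed.

HB.instance Definition _ :=
  @isMeasurable.Build measures_display measures measures_measurable
    measures_measurable0 measures_measurableC measures_measurableU.

End measure_space.

(* A random measure on T' is a kernel [N : R.-ker T ~> T']: by definition each
   [w |-> N w B] with B measurable is measurable. *)
Section restriction.
Context d d' (T : measurableType d) (T' : measurableType d') (R : realType).
Variables (N : R.-ker T ~> T') (D : set T') (mD : measurable D).

Definition restriction (w : T) : measures T' R := mrestr (N w) mD.

Let measurable_restriction : measurable_fun [set: T] restriction.
Proof.
apply: (@measurability _ _ T (measures T' R) setT restriction
  (@evaluation_sets _ T' R)) => //.
move=> _ [_ [B mB [Y mY <-]] <-].
have mBD : measurable (B `&` D) by exact: measurableI.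
by have := measurable_kernel N (B `&` D) mBD measurableT Y mY; rewrite !setTI.
Qed.

HB.instance Definition _ :=
  isMeasurableFun.Build _ _ T (measures T' R) restriction
    measurable_restriction.

End restriction.

Section point_process.
Context d (Omega : measurableType d) (R : realType).
Implicit Types (P : probability Omega R) (N : R.-ker Omega ~> measurableTypeR R)
  (F : R -> set_system Omega).

Definition law_on P N (i : interval R) :
    probability (measures (measurableTypeR R) R) R :=
  distribution P (restriction N (measurable_itv i)).

Definition locally_finite_counting
    (m : {measure set (measurableTypeR R) -> \bar R}) :=
  forall (a b : R) (B : set (measurableTypeR R)),
    measurable B -> B `<=` `[a, b] -> exists n : nat, m B = n%:R%:E.

Definition simple_point_process P N (s0 : R) :=
  [/\ forall w, locally_finite_counting (N w),
      forall w, N w `]-oo, s0]%classic = 0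
    & {ae P, forall w, forall t : R, N w [set t] <= 1}].

Definition natural_filtration N (t : R) : set_system Omega :=
  <<s \bigcup_(B in [set B | measurable B /\ B `<=` `]-oo, t]])
        preimage_set_system [set: Omega] (fun w => N w B) measurable >>.

Definition predictable_sets F (s0 : R) : set_system (Omega * R) :=
  <<s [set: Omega] `*` `]s0, +oo[,
      [set X | exists s t A,
        [/\ (s0 <= s)%R, (s < t)%R, F s A & X = A `*` `]s, t]]] >>.

Definition predictable F (s0 : R) (C : Omega * R -> \bar R) :=
  forall U : set (\bar R), measurable U ->
    predictable_sets F s0 (([set: Omega] `*` `]s0, +oo[) `&` C @^-1` U).

(* Bremaud's definition of the F-intensity of a point process on (s0, +oo),
   with the intensity taken predictable. *)
Definition stochastic_intensity P N F (s0 : R) (lambda : Omega -> R -> \bar R) :=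
  [/\ forall t, natural_filtration N t `<=` F t,
      (forall w t, (s0 < t)%R -> 0 <= lambda w t) /\
        predictable F s0 (fun x => lambda x.1 x.2),
      forall t, {ae P, forall w,
        \int[lebesgue_measure]_(s in `]s0, t]) lambda w s < +oo}
    & forall C : Omega * R -> \bar R,
        (forall w t, (s0 < t)%R -> 0 <= C (w, t)) -> predictable F s0 C ->
        \int[P]_w \int[N w]_(t in `]s0, +oo[) C (w, t) =
        \int[P]_w \int[lebesgue_measure]_(t in `]s0, +oo[)
          (C (w, t) * lambda w t)].

Definition hawkes_intensity (mu rho : R) (g : R -> R) N (s0 : R)
    (w : Omega) (t : R) : \bar R :=
  mu%:E + rho%:E * \int[N w]_(s in `]s0, t[) (g (t - s)%R)%:E.

Definition linear_hawkes (mu rho : R) (g : R -> R) (s0 : R) P N :=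
  simple_point_process P N s0 /\
  stochastic_intensity P N (natural_filtration N) s0
    (hawkes_intensity mu rho g N s0).

End point_process.

Definition kernel_shape (R : realType) (g : R -> R) :=
  [/\ forall x, (0 <= x)%R -> (0 <= g x)%R,
      measurable_fun (`[0%R, +oo[%classic : set R) g
    & \int[lebesgue_measure]_(x in `[0%R, +oo[) (g x)%:E = 1].

(* Main.v *)
Require Import Defs.
From HB Require Import structures.
From mathcomp Require Import all_boot all_order all_algebra.
From mathcomp Require Import all_classical all_reals all_analysis.
From mathcomp Require Import measurable_realfun.
From mathcomp Require Import zify ring lra.

Set Implicit Arguments.
Unset Strict Implicit.
Unset Printing Implicit Defensive.

Import Order.TTheory GRing.Theory Num.Theory.
Import numFieldNormedType.Exports.

Local Open Scope classical_set_scope.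
Local Open Scope ring_scope.

(** Write S(t) for the sum of g(t - x) over the points x before t, so that the
two processes have intensities lambda_j = mu + rho_j * S.

_Change of law._  Over a window ]s0, T'[ the likelihood of a configuration of
points is, up to a factor that does not depend on rho,
  dens rho = prod (lambda (x) / mu) * exp (- int lambda),
the product ranging over the points x of the configuration.  That the second
law has density dens rho1 / dens rho0 with respect to the first one is
[change_of_law].  The reason is that the weights 1 / dens turn both laws into
the same measure.  For a functional H of configurations, consider the mean of
  exp (int_s0^u lambda) * H / prod (lambda (x) / mu),
where H and the product are evaluated at the configuration of the points
before u.  Between two points only the exponential moves, at rate lambda; a
new point t turns H into H (. + t) and brings in a factor mu / lambda (t)
([path_identity]).  Taking means, the intensity of the process makes the
growth of the exponential cancel against the removed terms, and leaves
  mean (H, u) = H (empty) + int_s0^u mu * mean (H (. + t), t) dt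
([weighted_rec]), an equation without rho.  If H vanishes on configurations of
n points or more then H (. + t) vanishes on those of n - 1 points or more, so
that an induction on n shows that both processes yield the same mean
([weighted_eq]).

_Relative entropy._  Let f be the density of the first observed law with
respect to the second one and L = dens rho1 / dens rho0.  From
log (f L) <= f L - 1 and E (f L) <= 1, the relative entropy is at most
E (- log L) ([KL_le_log_bound]); this contains the loss of information in
observing the configuration on [0, T] only.  Then
  - log L <= sum (lambda_0 / lambda_1 - 1) - int (lambda_0 - lambda_1),
and the mean of the right-hand side is
  E int (lambda_0 - lambda_1)^2 / lambda_1
    <= (rho0 - rho1)^2 / rho1 * E int S
because lambda_1 >= rho1 * S.  As g has mass one, int S is at most the number
of points ([KL_le_excitation]), whose mean m satisfies
m <= mu * (T' - s0) + rho0 * m ([mean_number_le]).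

_The constant._  With rho0 - rho1 = delta * (1 - rho0) this gives
delta^2 * (1 - rho0) * mu * (T' - s0) / rho1, which is the announced bound for
the window of length T' - s0 = (T - s0) / rho0.  It ends after T, so that the
observation on the closed interval [0, T] is a function of the points of the
open window ]s0, T'[. *)

(** * Measurable functionals of configurations *)

Notation config R := (measures (measurableTypeR R) R).

Section configurations.
Local Open Scope ereal_scope.
Context (R : realType).
Implicit Types (xi : config R).

Lemma measurable_config d (X : measurableType d) (f : X -> config R) :
  (forall B, measurable B -> measurable_fun [set: X] (fun x => f x B)) ->
  measurable_fun [set: X] f.
Proof.
move=> mf.
apply: (@measurability _ _ X (config R) setT f
  (@evaluation_sets _ (measurableTypeR R) R)) => //.
move=> _ [_ [B mB [Y mY <-]] <-].
by have := mf B mB measurableT Y mY; rewrite !setTI.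
Qed.

Lemma measurable_eval (B : set (measurableTypeR R)) :
  measurable B -> measurable_fun [set: config R] (fun xi => xi B).
Proof.
move=> mB _ Y mY; rewrite setTI.
apply: sub_sigma_algebra; exists B => //; exists Y => //.
by rewrite setTI.
Qed.

Lemma measurable_comp_eval d (X : measurableType d) (f : X -> config R)
    (B : set (measurableTypeR R)) :
  measurable_fun [set: X] f -> measurable B ->
  measurable_fun [set: X] (fun x => f x B).
Proof. by move=> mf mB; exact: (measurableT_comp (measurable_eval mB) mf). Qed.

(** Integration against a configuration depends measurably on the
configuration only under a finiteness condition; infinite configurations are
sent to zero so that the functionals below are defined and measurable on all
of [config R]. *)
Definition fin_part xi : config R :=
  if xi [set: R] < +oo then xi else mzero.

Section fin_part_kernel.
Context d (X : measurableType d) (p : X -> config R).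
Hypothesis mp : measurable_fun [set: X] p.

Definition fin_part_at (x : X) : {measure set (measurableTypeR R) -> \bar R} :=
  fin_part (p x).

Definition fin_slice (n : nat) (x : X) :
    {measure set (measurableTypeR R) -> \bar R} :=
  if (n%:R%:E <= p x [set: R]) && (p x [set: R] < n.+1%:R%:E)
  then p x else mzero.

Let measurable_fin_part_at (U : set (measurableTypeR R)) :
  measurable U -> measurable_fun [set: X] (fin_part_at ^~ U).
Proof.
move=> mU; rewrite [X in measurable_fun _ X](_ : _ =
  fun x => if p x [set: R] < +oo then p x U else 0); last first.
  by apply/funext => x; rewrite /fin_part_at /fin_part; case: ifP.
apply: measurable_fun_ifT => //.
- apply: (@measurable_fun_bool _ _ _ _ true).
  by apply: emeasurable_fun_infty_o => //; exact: measurable_comp_eval.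
- exact: measurable_comp_eval.
Qed.

HB.instance Definition _ := isKernel.Build _ _ _ _ _ fin_part_at
  measurable_fin_part_at.

Let measurable_fin_slice n (U : set (measurableTypeR R)) :
  measurable U -> measurable_fun [set: X] (fin_slice n ^~ U).
Proof.
move=> mU; rewrite [X in measurable_fun _ X](_ : _ =
  fun x => if (n%:R%:E <= p x [set: R]) && (p x [set: R] < n.+1%:R%:E)
           then p x U else 0); last first.
  by apply/funext => x; rewrite /fin_slice; case: ifP.
apply: measurable_fun_ifT => //; last exact: measurable_comp_eval.
apply: measurable_and; apply: (@measurable_fun_bool _ _ _ _ true).
- by apply: emeasurable_fun_c_infty => //; exact: measurable_comp_eval.
- by apply: emeasurable_fun_infty_o => //; exact: measurable_comp_eval.
Qed.

HB.instance Definition _ n := isKernel.Build _ _ _ _ _ (fin_slice n)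
  (@measurable_fin_slice n).

Let fin_slice_uub n : measure_fam_uub (fin_slice n).
Proof.
exists n.+1%:R => x; rewrite /fin_slice; case: ifPn => [/andP[]//|_].
by rewrite /mzero lte_fin.
Qed.

Let fin_part_series : exists2 k : (R.-ker X ~> measurableTypeR R)^nat,
  forall n, measure_fam_uub (k n) &
  forall x U, measurable U -> fin_part_at x U = kseries k x U.
Proof.
exists fin_slice => //.
move=> x U mU; rewrite /fin_part_at /fin_part /kseries/= /mseries.
have slice0 (n : nat) : ~~ ((n%:R%:E <= p x [set: R]) &&
    (p x [set: R] < n.+1%:R%:E)) -> fin_slice n x U = 0.
  by rewrite /fin_slice => /negbTE ->.
have [px|px] := ltP (p x [set: R]) +oo; last first.
  rewrite eseries0// => n _ _; apply: slice0.
  by apply/negP => /andP[_ /(le_lt_trans px)]; rewrite ltNge leey.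
have pxf : p x [set: R] \is a fin_num by rewrite ge0_fin_numE.
set m := fine (p x [set: R]).
have m0 : (0 <= m)%R by exact: fine_ge0.
have pm : p x [set: R] = m%:E by rewrite fineK.
have /andP[km mk] := truncn_itv m0; set k := Num.trunc m in km mk.
rewrite (@nneseriesD1 _ _ k)//=.
rewrite eseries0 ?adde0//=; last first.
  move=> n _ nk; apply: slice0; rewrite -/m pm lee_fin lte_fin.
  apply/negP => /andP[nm mn]; move/eqP : nk; apply.
  apply/eqP; rewrite eqn_leq -ltnS -(ltnS k).
  by rewrite -!(ltr_nat R) (le_lt_trans nm mk) (le_lt_trans km mn).
by rewrite /fin_slice pm lee_fin lte_fin km mk.
Qed.

HB.instance Definition _ :=
  isSFiniteKernel_subdef.Build _ _ _ _ _ fin_part_at fin_part_series.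

(** Slicing the configurations by their number of points, between n and n + 1,
makes the finite part an s-finite kernel, to which the measurability of
parametrised integrals applies. *)
Lemma measurable_fin_part_integral (h : X * measurableTypeR R -> \bar R) :
  (forall z, 0 <= h z) -> measurable_fun setT h ->
  measurable_fun [set: X] (fun x => \int[fin_part (p x)]_y h (x, y)).
Proof.
by move=> h0 mh; exact: (@measurable_fun_integral_sfinite_kernel _ _ _ _ _ h
  (fin_part_at : R.-sfker X ~> measurableTypeR R)).
Qed.

End fin_part_kernel.

End configurations.

(** * Configurations given by lists of points *)

Section finite_configurations.
Local Open Scope ereal_scope.
Context (R : realType).
Implicit Types (xi : config R) (t : R) (s : seq R).

(** Lists of points are read with the newest point first: the past of a point
is then the tail of the list, and adding a point is [cons]. *)
Fixpoint conf s : config R :=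
  if s is x :: s' then measure_add (dirac (x : measurableTypeR R)) (conf s')
  else mzero.

Definition before t xi : config R :=
  mrestr (fin_part xi) (measurable_itv `]-oo, t[).

Definition add_point xi t : config R :=
  measure_add xi (dirac (t : measurableTypeR R)).

Lemma config_eq xi xi' : (forall B, xi B = xi' B) -> xi = xi'.
Proof. by move=> h; apply: eq_measure; apply/funext. Qed.

Lemma conf_cons x s (B : set R) : conf (x :: s) B = (\1_B x)%:E + conf s B.
Proof. exact: measure_addE. Qed.

Lemma add_pointE xi t (B : set R) : add_point xi t B = xi B + (\1_B t)%:E.
Proof. exact: measure_addE. Qed.

Lemma confE s (B : set R) : conf s B = (\sum_(x <- s) \1_B x)%R%:E.
Proof.
elim: s => [|x s ih]; first by rewrite big_nil.
by rewrite conf_cons ih big_cons EFinD.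
Qed.

Lemma conf_setT s : conf s [set: R] = (size s)%:R%:E.
Proof.
rewrite confE; congr EFin; elim: s => [|x s ih]; first by rewrite big_nil.
by rewrite big_cons ih indicT /= -natr1 addrC.
Qed.

Lemma fin_part_conf s : fin_part (conf s) = conf s.
Proof. by rewrite /fin_part conf_setT ltry. Qed.

Lemma integral_conf s (f : R -> \bar R) :
  measurable_fun [set: measurableTypeR R] f -> (forall x, 0 <= f x) ->
  \int[conf s]_x f x = \sum_(x <- s) f x.
Proof.
move=> mf f0; elim: s => [|x s ih].
  by rewrite big_nil integral_measure_zero.
rewrite big_cons -ih ge0_integral_measure_add//.
by rewrite integral_dirac// diracT mul1e.
Qed.

Lemma before_conf t s : before t (conf s) = conf [seq x <- s | (x < t)%R].
Proof.
apply: config_eq => B.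
rewrite /before /= /mrestr fin_part_conf !confE; congr EFin.
rewrite big_filter [RHS]big_mkcond/=; apply: eq_bigr => x _.
rewrite indicI /= [X in (_ * X)%R]indicE/= mem_setE in_itv/=.
by case: ifP => _; rewrite ?mulr1 ?mulr0.
Qed.

Lemma add_point_conf s t : add_point (conf s) t = conf (t :: s).
Proof. by apply: config_eq => B; rewrite add_pointE conf_cons addeC. Qed.

Section measurability.
Context d (X : measurableType d) (p : X -> config R) (u : X -> R).
Hypotheses (mp : measurable_fun setT p) (mu : measurable_fun setT u).

Lemma measurable_before : measurable_fun setT (fun x => before (u x) (p x)).
Proof.
apply: measurable_config => B mB.
have -> : (fun x => before (u x) (p x) B) = fun x =>
    \int[fin_part (p x)]_y (\1_(B `&` `]-oo, u x[) y)%:E.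
  by apply/funext => x; rewrite integral_indic ?setIT//; exact: measurableI.
pose h (z : X * measurableTypeR R) : \bar R :=
  (\1_B z.2 * (if z.2 < u z.1 then 1 else 0))%R%:E.
have -> : (fun x => \int[fin_part (p x)]_y (\1_(B `&` `]-oo, u x[) y)%:E) =
    fun x => \int[fin_part (p x)]_y h (x, y).
  apply/funext => x; apply: eq_integral => y _; rewrite indicI /h/=.
  by rewrite [X in (_ * X)%R]indicE/= mem_setE in_itv/=; case: ifP.
apply: measurable_fin_part_integral => //.
  by move=> z; rewrite lee_fin mulr_ge0//; case: ifP.
apply/measurable_EFinP; apply: measurable_funM.
  by apply: (@measurableT_comp _ _ _ _ _ _ (\1_B : measurableTypeR R -> R));
    [exact: measurable_indic|exact: measurable_snd].
apply: measurable_fun_ifT => //; apply: measurable_fun_ltr.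
  exact: measurable_snd.
by apply: measurableT_comp => //; exact: measurable_fst.
Qed.

Lemma measurable_add_point : measurable_fun setT (fun x => add_point (p x) (u x)).
Proof.
apply: measurable_config => B mB.
have -> : (fun x => add_point (p x) (u x) B) =
    fun x => p x B + (\1_B (u x))%:E.
  by apply/funext => x; rewrite add_pointE.
apply: emeasurable_funD; first exact: measurable_comp_eval.
apply/measurable_EFinP.
by apply: (@measurableT_comp _ _ _ _ _ _ (\1_B : measurableTypeR R -> R)).
Qed.

End measurability.

End finite_configurations.

Arguments conf {R} s : simpl never.

(** * Exponential of a compensator *)

(** The identity d(exp L) = exp L dL for a continuous nondecreasing L, without
derivatives: L is merely the primitive of an integrable function, hence
differentiable only almost everywhere. *)
Section exponential_of_additive.
Context (R : realType) (s0 : R) (L : R -> R) (V : R -> R -> R).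
Hypothesis L_le : forall a b, a <= b -> L a <= L b.
Hypothesis L_continuous : forall b, s0 <= b -> {within `[s0, b], continuous L}.
Hypothesis V_split : forall a b c, s0 <= a -> a <= b -> b <= c ->
  V a c = V a b + V b c.
Hypothesis V_bounds : forall a b, s0 <= a -> a <= b ->
  expR (L a) * (L b - L a) <= V a b <= expR (L b) * (L b - L a).

Let defect a b := V a b - (expR (L b) - expR (L a)).

Let defect_split a b c : s0 <= a -> a <= b -> b <= c ->
  defect a c = defect a b + defect b c.
Proof. by move=> s0a ab bc; rewrite /defect (V_split s0a ab bc); ring. Qed.

Let defect_le a b B : s0 <= a -> a <= b -> b <= B ->
  `|defect a b| <= expR (L B) * (L b - L a) ^+ 2.
Proof.
move=> s0a ab bB; have /andP[] := V_bounds s0a ab; rewrite /defect.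
have := L_le ab; have := L_le bB.
move: (L a) (L b) (L B) (V a b) => x y z v pbB pab h1 h2.
have ex : expR y = expR x * expR (y - x) by rewrite -expRD addrC subrK.
have ey : expR x = expR y * expR (x - y) by rewrite -expRD addrC subrK.
have h3 : expR x * (1 + (y - x)) <= expR y.
  by rewrite ex ler_wpM2l ?expR_ge0// expR_ge1Dx.
have h4 : expR y * (1 + (x - y)) <= expR x.
  by rewrite [leRHS]ey ler_wpM2l ?expR_ge0// expR_ge1Dx.
have h7 : expR y * (y - x) ^+ 2 <= expR z * (y - x) ^+ 2.
  by rewrite ler_wpM2r ?sqr_ge0// ler_expR.
apply: le_trans h7.
have h8 : (expR y - expR x) * (y - x) <= expR y * (y - x) ^+ 2.
  have -> : expR y * (y - x) ^+ 2 = (expR y * (y - x)) * (y - x) by ring.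
  by rewrite ler_wpM2r ?subr_ge0//; lra.
by apply: le_trans h8; rewrite ler_norml; apply/andP; split; lra.
Qed.

(** The defect of an interval is quadratic in the increment of L.  Cutting at a
point where L takes its middle value halves the increments, so that the two
defects add up to half of the former bound. *)
Let defect_le_pow k B a b : s0 <= a -> a <= b -> b <= B ->
  `|defect a b| * 2 ^+ k <= expR (L B) * (L b - L a) ^+ 2.
Proof.
elim: k a b => [|k ih] a b s0a ab bB.
  by rewrite expr0 mulr1; exact: defect_le.
have pab := L_le ab.
have [c cab pc] : exists2 c, c \in `[a, b] & L c = (L a + L b) / 2.
  apply: IVT => //.
    apply: continuous_subspaceW (L_continuous (le_trans s0a ab)).
    by apply: subset_itvr; rewrite bnd_simp.
  by rewrite min_l// max_r//; apply/andP; split; lra.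
move: cab; rewrite in_itv/= => /andP[ac cb].
have := ih _ _ s0a ac (le_trans cb bB); have := ih _ _ (le_trans s0a ac) cb bB.
rewrite (defect_split s0a ac cb) pc.
have := ler_normD (defect a c) (defect c b).
set u := `|_ + _|; set v := `|_|; set w := `|_| => uvw h1 h2.
have p0 : 0 <= (2 : R) ^+ k by rewrite exprn_ge0.
have h3 : u * 2 ^+ k <= (v + w) * 2 ^+ k by rewrite ler_wpM2r.
rewrite exprS.
have -> : expR (L B) * (L b - L a) ^+ 2 =
  2 * (expR (L B) * ((L a + L b) / 2 - L a) ^+ 2 +
   expR (L B) * (L b - (L a + L b) / 2) ^+ 2) by field.
lra.
Qed.

Lemma additive_expR a b : s0 <= a -> a <= b -> V a b = expR (L b) - expR (L a).
Proof.
move=> s0a ab; apply/eqP; rewrite -subr_eq0 -/(defect a b).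
rewrite -normr_eq0; apply/negPn/negP => d0.
set C := expR (L b) * (L b - L a) ^+ 2.
have dpos : 0 < `|defect a b| by rewrite lt_neqAle eq_sym d0/=.
set k := Num.trunc (C / `|defect a b|).
have C0 : 0 <= C by rewrite mulr_ge0 ?expR_ge0// sqr_ge0.
have /andP[_] := truncn_itv (divr_ge0 C0 (ltW dpos)).
rewrite -/k ltr_pdivrMr// => hk.
have := defect_le_pow k.+1 s0a ab (lexx b); rewrite -/C leNgt => /negP; apply.
apply: (lt_le_trans hk); rewrite mulrC ler_wpM2l//.
by rewrite -natrX ler_nat ltnW// ltn_expl.
Qed.

End exponential_of_additive.

Section exponential_of_primitive.
Context (R : realType).
Local Notation leb := (@lebesgue_measure R).

Lemma integral_oo_split (f : R -> \bar R) (a b c : R) :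
  a <= b -> b <= c -> (forall x, 0 <= f x)%E -> measurable_fun setT f ->
  (\int[leb]_(r in `]a, c[) f r =
   \int[leb]_(r in `]a, b[) f r + \int[leb]_(r in `]b, c[) f r)%E.
Proof.
move=> ab bc f0 mf; have mfD D : measurable_fun D f by exact: measurable_funTS.
have [<-|ab'] := eqVneq a b; first by rewrite set_itvoo0 integral_set0 add0e.
have [->|bc'] := eqVneq b c; first by rewrite set_itvoo0 integral_set0 adde0.
have {ab'}ab : a < b by rewrite lt_neqAle ab'.
have {bc'}bc : b < c by rewrite lt_neqAle bc'.
rewrite [X in (_ = X + _)%E]integral_itv_bndo_bndc//.
rewrite -ge0_integral_setU//=.
- congr integral; apply/seteqP; split => x /=; rewrite !in_itv/=.
    by move=> /andP[-> ->]; case: leP; [left|right].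
  case=> /andP[h1 h2]; rewrite ?h1 ?h2 ?andbT/=.
    exact: le_lt_trans bc.
  exact: lt_trans h1.
- exact: mfD.
- rewrite disj_set2E; apply/eqP/seteqP; split => x //=; rewrite !in_itv/=.
  by move=> [/andP[_ h] /andP[]]; rewrite ltNge h.
Qed.

Variables (s0 : R) (l : R -> R).
Hypothesis l_ge0 : forall x, 0 <= l x.
Hypothesis ml : measurable_fun setT l.
Hypothesis l_fin : forall t, (\int[leb]_(r in `]s0, t[) (l r)%:E < +oo)%E.

Definition prim (t : R) : R := \int[leb]_(r in `]s0, t[) l r.

Let mlE D : measurable_fun D (EFin \o l).
Proof. by apply/measurable_EFinP/measurable_funTS. Qed.

Let primE t : (\int[leb]_(r in `]s0, t[) (l r)%:E)%E = (prim t)%:E.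
Proof.
rewrite /prim /Rintegral fineK// ge0_fin_numE//.
by apply: integral_ge0 => x _; rewrite lee_fin.
Qed.

Lemma integral_prim a b : s0 <= a -> a <= b ->
  (\int[leb]_(r in `]a, b[) (l r)%:E)%E = (prim b - prim a)%:E.
Proof.
move=> s0a ab; have := @integral_oo_split (EFin \o l) _ _ _ s0a ab.
rewrite /= !primE EFinB => -> //.
by rewrite addeAC subee// add0e.
Qed.

Lemma prim_le a b : a <= b -> prim a <= prim b.
Proof.
move=> ab; rewrite -lee_fin -!primE; apply: ge0_subset_integral => //.
- exact: mlE.
- by move=> x _; rewrite lee_fin.
- by apply: subset_itvl; rewrite bnd_simp.
Qed.

Lemma measurable_prim : measurable_fun setT prim.
Proof. by apply: nondecreasing_measurable => // a b *; exact: prim_le. Qed.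

Lemma prim_continuous b : s0 <= b -> {within `[s0, b], continuous prim}.
Proof.
move=> s0b.
have -> : prim = fun x => parameterized_integral leb s0 x l.
  apply/funext => x; rewrite /prim /parameterized_integral /Rintegral.
  congr fine; apply/esym; apply: integral_itv_bndoo; exact: mlE.
apply: parameterized_integral_continuous => //.
apply/integrableP; split; first exact: mlE.
rewrite (_ : (\int[_]_(x in _) _)%E = (\int[leb]_(r in `]s0, b[) (l r)%:E)%E)//.
rewrite integral_itv_bndoo//; last first.
  by apply: measurableT_comp => //; exact: mlE.
by apply: eq_integral => x _ /=; rewrite ger0_norm.
Qed.

Lemma integral_expR_prim a b : s0 <= a -> a <= b ->
  (\int[leb]_(r in `]a, b[) (l r * expR (prim r))%:E =
   (expR (prim b) - expR (prim a))%:E)%E.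
Proof.
have := integral_prim; have := prim_le; have := prim_continuous.
have := measurable_prim; move: prim => L mL cL L_le lL.
have mle D : measurable_fun D (fun r => (l r * expR (L r))%:E).
  apply/measurable_EFinP/measurable_funTS; apply: measurable_funM => //.
  exact: measurableT_comp.
have le_ge0 r : (0 <= (l r * expR (L r))%:E)%E.
  by rewrite lee_fin mulr_ge0// expR_ge0.
pose V a b := (\int[leb]_(r in `]a, b[) (l r * expR (L r))%:E)%E.
have bounds a' b' : s0 <= a' -> a' <= b' ->
    ((expR (L a') * (L b' - L a'))%:E <= V a' b' <=
     (expR (L b') * (L b' - L a'))%:E)%E.
  move=> s0a ab; have scaled k : 0 <= k -> ((k * (L b' - L a'))%:E =
      \int[leb]_(r in `]a', b'[) (l r * k)%:E)%E.
    move=> k0; rewrite EFinM -(lL _ _ s0a ab) -ge0_integralZl_EFin//.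
    - by apply: eq_integral => r _; rewrite -EFinM mulrC.
    - by move=> r _; rewrite lee_fin.
    - exact: mlE.
  have mlk k : measurable_fun `]a', b'[ (fun r => (l r * k)%:E).
    by apply/measurable_EFinP/measurable_funTS; exact: measurable_funM.
  rewrite !scaled ?expR_ge0//; apply/andP; split.
  - apply: ge0_le_integral => //.
    + by move=> r _; rewrite lee_fin mulr_ge0// expR_ge0.
    + exact: mlk.
    + exact: mle.
    + move=> r /=; rewrite in_itv/= => /andP[/ltW/L_le ar _].
      by rewrite lee_fin ler_wpM2l// ler_expR.
  - apply: ge0_le_integral => //.
    + exact: mle.
    + exact: mlk.
    + move=> r /=; rewrite in_itv/= => /andP[_ /ltW/L_le rb].
      by rewrite lee_fin ler_wpM2l// ler_expR.
have V_fin a' b' : s0 <= a' -> a' <= b' -> V a' b' \is a fin_num.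
  move=> s0a ab; rewrite ge0_fin_numE; last by apply: integral_ge0 => r _.
  by have /andP[_ /le_lt_trans] := bounds _ _ s0a ab; apply; exact: ltry.
move=> s0a ab; rewrite -[LHS](fineK (V_fin _ _ s0a ab)); congr EFin.
apply: (additive_expR (V := fun a b => fine (V a b)) L_le cL _ _ s0a ab).
- move=> a' b' c s0a' ab' bc.
  rewrite -fineD ?V_fin ?(le_trans s0a')//; congr fine.
  exact: integral_oo_split.
- move=> a' b' s0a' ab'; rewrite -!lee_fin fineK ?V_fin//.
  exact: bounds.
Qed.

End exponential_of_primitive.

Lemma measurable_itv_integral (R : realType) d (X : measurableType d)
    (h : X * measurableTypeR R -> \bar R) (a : R) (v : X -> R) :
  (forall z, 0 <= h z)%E -> measurable_fun setT h -> measurable_fun setT v ->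
  measurable_fun setT
    (fun x => \int[@lebesgue_measure R]_(t in `]a, v x[) h (x, t))%E.
Proof.
move=> h0 mh mv.
pose h' (z : X * measurableTypeR R) :=
  (if (a < z.2 < v z.1)%R then h z else 0)%E.
rewrite [X in measurable_fun _ X](_ : _ =
    fun x => (\int[@lebesgue_measure R]_t h' (x, t))%E); last first.
  apply/funext => x; rewrite integral_mkcond; apply: eq_integral => t _.
  by rewrite patchE mem_setE in_itv.
apply: (measurable_fun_fubini_tonelli_F (m2 := @lebesgue_measure R) h').
  apply: measurable_fun_ifT => //; apply: measurable_and.
    by apply: measurable_fun_ltr => //; exact: measurable_snd.
  apply: measurable_fun_ltr; first exact: measurable_snd.
  by apply: measurableT_comp => //; exact: measurable_fst.
by move=> z; rewrite /h'; case: ifP.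
Qed.

(** * Integration by parts along a path *)

Section newest_first.
Context (R : realType).
Implicit Types (s : seq R) (t : R).

Lemma filter_lt_id s t : {in s, forall y, y < t} -> [seq y <- s | y < t] = s.
Proof. by move=> h; apply/all_filterP/allP => y /h. Qed.

Lemma filter_lt_cons_le x s t : t <= x ->
  [seq y <- x :: s | y < t] = [seq y <- s | y < t].
Proof. by move=> tx /=; rewrite ltNge tx. Qed.

Lemma sorted_gt_cons x s : sorted >%R (x :: s) ->
  sorted >%R s /\ {in s, forall y, y < x}.
Proof.
move=> h; split; first exact: path_sorted h.
move=> y ys; have gt_tr : transitive (>%R : rel R) by move=> a b c ba ca; exact: lt_trans ba.
by have /allP/(_ _ ys) := order_path_min gt_tr h.
Qed.

Lemma measurable_filter_lt (H : seq R -> R) s : sorted >%R s ->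
  measurable_fun setT (fun t : R => H [seq y <- s | y < t]).
Proof.
elim: s => [|x s ih] /=; first by move=> _; exact: measurable_cst.
move=> /sorted_gt_cons[ss sx].
have -> : (fun t => H (if x < t then x :: [seq y <- s | y < t]
    else [seq y <- s | y < t])) =
    fun t => if x < t then H (x :: s) else H [seq y <- s | y < t].
  apply/funext => t; case: ifP => // xt.
  by rewrite filter_lt_id// => y /sx /lt_trans; apply.
apply: measurable_fun_ifT; [exact: measurable_fun_ltr|exact: measurable_cst|].
exact: ih.
Qed.

End newest_first.

Section path_identity.
Context (R : realType) (s0 : R) (l L : R -> R) (H : seq R -> R).
Local Notation leb := (@lebesgue_measure R).
Hypothesis l_ge0 : forall x, 0 <= l x.
Hypothesis ml : measurable_fun setT l.
Hypothesis mL : measurable_fun setT L.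
Hypothesis L0 : L s0 = 0.
Hypothesis lL : forall a b, s0 <= a -> a <= b ->
  (\int[leb]_(r in `]a, b[) (l r * expR (L r))%:E =
   (expR (L b) - expR (L a))%:E)%E.
Hypothesis H_ge0 : forall s, 0 <= H s.

(** The functional exp (L u) * H evaluated along the path of the points [s] and
written as the sum of its variations.  Between points it grows at rate
l * exp L * H; at a point x, the value H of the strict past is replaced by the
value after x.  The replaced terms are put on the right, so that both sides
consist of nonnegative terms.  The induction removes the newest point x: after
x the value of H no longer changes, before x the path is that of the other
points. *)
Lemma path_identity s u : sorted >%R s -> {in s, forall y, s0 < y < u} ->
  s0 <= u ->
  ((H [::] + \sum_(x <- s) expR (L x) * H (x :: [seq y <- s | y < x]))%R%:E +
   \int[leb]_(t in `]s0, u[) (H [seq y <- s | y < t] * (l t * expR (L t)))%:E =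
   (expR (L u) * H s + \sum_(x <- s) expR (L x) * H [seq y <- s | y < x])%R%:E)%E.
Proof.
elim: s u => [|x s ih] u.
  move=> _ _ s0u /=; rewrite !big_nil !addr0.
  under eq_integral do rewrite EFinM.
  rewrite ge0_integralZl_EFin//.
  - by rewrite lL// -EFinM -EFinD L0 expR0; congr EFin; ring.
  - by move=> t _; rewrite lee_fin mulr_ge0 ?expR_ge0.
  - apply/measurable_EFinP/measurable_funTS; apply: measurable_funM => //.
    exact: measurableT_comp.
move=> xss xsu s0u; have [ss sx] := sorted_gt_cons xss.
have /andP[s0x xu] := xsu x (mem_head _ _).
have mHt (s' : seq R) : sorted >%R s' -> measurable_fun setT
    (fun t : R => (H [seq y <- s' | y < t] * (l t * expR (L t)))%:E).
  move=> ss'; apply/measurable_EFinP; apply: measurable_funM.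
    exact: measurable_filter_lt.
  by apply: measurable_funM => //; exact: measurableT_comp.
rewrite (@integral_oo_split _ _ s0 x u (ltW s0x) (ltW xu)); last 2 first.
- by move=> t; rewrite lee_fin mulr_ge0// mulr_ge0 ?expR_ge0.
- exact: mHt.
have -> : (\int[leb]_(t in `]s0, x[)
    (H [seq y <- x :: s | y < t] * (l t * expR (L t)))%:E =
    \int[leb]_(t in `]s0, x[)
    (H [seq y <- s | y < t] * (l t * expR (L t)))%:E)%E.
  apply: eq_integral => t; rewrite inE/= in_itv/= => /andP[_ tx].
  by rewrite ltNge (ltW tx).
have -> : (\int[leb]_(t in `]x, u[)
    (H [seq y <- x :: s | y < t] * (l t * expR (L t)))%:E =
    (H (x :: s) * (expR (L u) - expR (L x)))%:E)%E.
  rewrite EFinM -lL ?(ltW s0x) ?(ltW xu)//.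
  rewrite -ge0_integralZl_EFin//.
  - apply: eq_integral => t; rewrite inE => /andP[xt _].
    rewrite -EFinM filter_lt_id// => y; rewrite inE => /predU1P[->//|/sx].
    by move=> /lt_trans; apply.
  - by move=> t _; rewrite lee_fin mulr_ge0 ?expR_ge0.
  - apply/measurable_EFinP/measurable_funTS; apply: measurable_funM => //.
    exact: measurableT_comp.
have sxs : {in s, forall y, s0 < y < x}.
  move=> y ys; have /andP[-> _] /= := xsu y (mem_behead (s := x :: s) ys).
  exact: sx.
have := ih x ss sxs (ltW s0x).
set I := (\int[leb]_(t in `]s0, x[) _)%E => hI.
rewrite !big_cons filter_lt_cons_le// filter_lt_id//.
have -> : \sum_(j <- s) expR (L j) * H (j :: [seq y <- x :: s | y < j]) =
    \sum_(j <- s) expR (L j) * H (j :: [seq y <- s | y < j]).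
  rewrite [LHS]big_seq [RHS]big_seq; apply: eq_bigr => j /sx jx.
  by rewrite filter_lt_cons_le// ltW.
have -> : \sum_(j <- s) expR (L j) * H [seq y <- x :: s | y < j] =
    \sum_(j <- s) expR (L j) * H [seq y <- s | y < j].
  rewrite [LHS]big_seq [RHS]big_seq; apply: eq_bigr => j /sx jx.
  by rewrite filter_lt_cons_le// ltW.
move: hI; set S1 := \sum_(_ <- s) _; set S2 := \sum_(_ <- s) _.
have -> : (H [::] + (expR (L x) * H (x :: s) + S1))%:E =
  ((H [::] + S1)%:E + (expR (L x) * H (x :: s))%:E)%E.
  by rewrite -EFinD; congr EFin; ring.
rewrite addeACA => ->.
by rewrite -!EFinD; congr EFin; ring.
Qed.

End path_identity.

(** * Hawkes intensity as a functional of a configuration *)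

Lemma lebesgue_measure_shift (R : realType) (x : R) (A : set (measurableTypeR R)) :
  measurable A ->
  pushforward (@lebesgue_measure R) (shift x : R -> measurableTypeR R) A =
  lebesgue_measure A.
Proof.
move=> mA; apply/esym/lebesgue_measure_unique => //=.
  exact: measurable_funD.
move=> mshift _ [[a b]] _ <-.
rewrite /pushforward (_ : _ @^-1` _ = `]a - x, b - x]%classic); last first.
  by apply/seteqP; split => y; rewrite /= !in_itv/= ltrBlDr lerBrDr.
rewrite !lebesgue_measure_itv/= !lte_fin ltrD2r; case: ifP => // _.
by rewrite -!EFinB; congr EFin; ring.
Qed.

Section hawkes_functionals.
Context (R : realType) (mu s0 : R) (g : R -> R).
Local Notation leb := (@lebesgue_measure R).
Hypothesis mu_gt0 : 0 < mu.
Hypothesis g_shape : kernel_shape g.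
Implicit Types (xi : config R) (rho t : R) (s : seq R).

(** The kernel extended by zero to u <= 0, so that the excitation at time t
may be summed over all points: those at t or later do not contribute. *)
Definition past (u : R) : R := if 0 < u then g u else 0.

Lemma past_ge0 u : 0 <= past u.
Proof.
by rewrite /past; case: ifPn => // u0; case: g_shape => + _ _; apply; exact: ltW.
Qed.

Lemma measurable_past : measurable_fun setT past.
Proof.
have [_ mg _] := g_shape.
have -> : past = (g \_ `]0, +oo[).
  by apply/funext => u; rewrite /past patchE mem_setE in_itv/= andbT.
apply/(measurable_restrictT g) => //.
by apply: measurable_funS mg => //; apply: subset_itvr; rewrite bnd_simp.
Qed.

Lemma measurable_past_comp d (X : measurableType d) (u v : X -> R) :
  measurable_fun setT u -> measurable_fun setT v ->
  measurable_fun setT (fun x => past (u x - v x)).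
Proof.
move=> mu' mv; apply: measurableT_comp; first exact: measurable_past.
exact: measurable_funB.
Qed.

Lemma integral_past_le (a b x : R) :
  (\int[leb]_(t in `]a, b[) (past (t - x))%:E <= 1)%E.
Proof.
have mpx : measurable_fun setT (EFin \o past).
  by apply/measurable_EFinP; exact: measurable_past.
apply: (@le_trans _ _ (\int[leb]_t (past (t - x))%:E)%E).
  apply: ge0_subset_integral => //.
    by apply/measurable_EFinP; apply: measurable_past_comp.
  by move=> t _; rewrite lee_fin past_ge0.
have -> : (\int[leb]_t (past (t - x))%:E = \int[leb]_t (past t)%:E)%E.
  transitivity (\int[pushforward leb (shift (- x) : R -> measurableTypeR R)]_t
      (past t)%:E)%E.
    rewrite ge0_integral_pushforward//=; first exact: measurable_funD.
    by move=> t _; rewrite lee_fin past_ge0.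
  apply: eq_measure_integral => [|mshift A mA _]; first exact: measurable_funD.
  exact: lebesgue_measure_shift.
have [g0 mg <-] := g_shape.
have -> : (\int[leb]_t (past t)%:E)%E = (\int[leb]_(t in `]0%R, +oo[) (g t)%:E)%E.
  rewrite [RHS]integral_mkcond; apply: eq_integral => t _.
  by rewrite /past patchE mem_setE in_itv/= andbT; case: ifP.
apply: ge0_subset_integral => //.
- by apply/measurable_EFinP.
- by move=> t; rewrite /= in_itv/= andbT lee_fin; exact: g0.
- by apply: subset_itvr; rewrite bnd_simp.
Qed.

Definition excitation xi t : R :=
  fine (\int[fin_part xi]_x (past (t - x))%:E).

Definition rate rho xi t : R := mu + rho * excitation xi t.

(** The product of [rate / mu] over the points, written as the exponential of
an integral to be measurable in the configuration ([rate_prod_conf]).  The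
factor 1 / mu makes it at least one. *)
Definition rate_prod rho xi : R :=
  expR (fine (\int[fin_part xi]_x (ln (rate rho xi x / mu))%:E)).

Lemma excitation_ge0 xi t : 0 <= excitation xi t.
Proof. by apply/fine_ge0/integral_ge0 => x _; rewrite lee_fin past_ge0. Qed.

Lemma excitation_conf s t : excitation (conf s) t = \sum_(x <- s) past (t - x).
Proof.
rewrite /excitation fin_part_conf integral_conf ?sumEFin//.
- by apply/measurable_EFinP; exact: measurable_past_comp.
- by move=> x; rewrite lee_fin past_ge0.
Qed.

Lemma rate_ge rho xi t : 0 <= rho -> mu <= rate rho xi t.
Proof. by move=> rho0; rewrite lerDl mulr_ge0// excitation_ge0. Qed.

Lemma rate_gt0 rho xi t : 0 <= rho -> 0 < rate rho xi t.
Proof. by move=> rho0; exact: lt_le_trans (rate_ge _ _ rho0). Qed.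

Lemma rate_prod_gt0 rho xi : 0 < rate_prod rho xi.
Proof. exact: expR_gt0. Qed.

Lemma rate_prod_ge1 rho xi : 0 <= rho -> 1 <= rate_prod rho xi.
Proof.
move=> rho0; rewrite -expR0 ler_expR.
apply/fine_ge0/integral_ge0 => x _; rewrite lee_fin ln_ge0//.
by rewrite ler_pdivlMr// mul1r rate_ge.
Qed.

Section measurability.
Context d (X : measurableType d) (p : X -> config R) (u : X -> R).
Hypotheses (mp : measurable_fun setT p) (mu_ : measurable_fun setT u).

Lemma measurable_excitation :
  measurable_fun setT (fun x => excitation (p x) (u x)).
Proof.
apply: (measurableT_comp (@fine_measurable R setT measurableT)).
apply: (measurable_fin_part_integral mp (h := fun z => (past (u z.1 - z.2))%:E)).
  by move=> z; rewrite lee_fin past_ge0.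
apply/measurable_EFinP/measurable_past_comp; last exact: measurable_snd.
by apply: measurableT_comp => //; exact: measurable_fst.
Qed.

Lemma measurable_rate rho :
  measurable_fun setT (fun x => rate rho (p x) (u x)).
Proof.
apply: measurable_funD => //; apply: measurable_funM => //.
exact: measurable_excitation.
Qed.

End measurability.

Section likelihood_measurability.
Context d (X : measurableType d) (p : X -> config R) (u : X -> R).
Hypotheses (mp : measurable_fun setT p) (mu_ : measurable_fun setT u).

Lemma measurable_rate_prod rho : 0 <= rho ->
  measurable_fun setT (fun x => rate_prod rho (p x)).
Proof.
move=> rho0; apply: (measurableT_comp (@measurable_expR R)).
apply: (measurableT_comp (@fine_measurable R setT measurableT)).
apply: (measurable_fin_part_integral mp
  (h := fun z => (ln (rate rho (p z.1) z.2 / mu))%:E)).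
  move=> z; rewrite lee_fin ln_ge0// ler_pdivlMr// mul1r rate_ge//.
apply/measurable_EFinP; apply: measurableT_comp => //.
apply: measurable_funM => //; apply: measurable_rate.
  by apply: measurableT_comp => //; exact: measurable_fst.
exact: measurable_snd.
Qed.

Lemma measurable_prim_rate rho : 0 <= rho ->
  measurable_fun setT (fun x => prim s0 (rate rho (p x)) (u x)).
Proof.
move=> rho0.
apply: (measurableT_comp (@fine_measurable R setT measurableT)).
apply: (measurable_itv_integral (h := fun z => (rate rho (p z.1) z.2)%:E)) => //.
  by move=> z; rewrite lee_fin ltW// rate_gt0.
apply/measurable_EFinP; apply: measurable_rate; last exact: measurable_snd.
by apply: measurableT_comp => //; exact: measurable_fst.
Qed.

End likelihood_measurability.

Lemma measurable_rate_time rho xi : measurable_fun setT (rate rho xi).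
Proof. by apply: (@measurable_rate _ _ (fun=> xi) id). Qed.

Lemma past_le0 u : u <= 0 -> past u = 0.
Proof. by rewrite /past ltNge => ->. Qed.

(** The functionals at time t only see the points before t; this is what makes
them predictable. *)
Lemma excitation_before s t r : r <= t ->
  excitation (conf [seq y <- s | y < t]) r = excitation (conf s) r.
Proof.
move=> rt; rewrite !excitation_conf big_filter big_mkcond/=.
apply: eq_bigr => x _; case: ltP => // tx.
by rewrite past_le0// subr_le0 (le_trans rt).
Qed.

Lemma rate_before rho s t r : r <= t ->
  rate rho (conf [seq y <- s | y < t]) r = rate rho (conf s) r.
Proof. by move=> rt; rewrite /rate excitation_before. Qed.

Lemma prim_rate_before rho s t :
  prim s0 (rate rho (conf [seq y <- s | y < t])) t = prim s0 (rate rho (conf s)) t.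
Proof.
apply: eq_Rintegral => r; rewrite inE/= in_itv/= => /andP[_ rt].
by rewrite rate_before// ltW.
Qed.

Lemma rate_prod_conf rho s : 0 <= rho ->
  rate_prod rho (conf s) = \prod_(x <- s) (rate rho (conf s) x / mu).
Proof.
move=> rho0; rewrite /rate_prod fin_part_conf integral_conf//.
- rewrite sumEFin/= expR_sum; apply: eq_bigr => x _.
  by rewrite lnK// posrE divr_gt0// rate_gt0.
- apply/measurable_EFinP; apply: measurableT_comp => //.
  by apply: measurable_funM => //; exact: measurable_rate_time.
- by move=> x; rewrite lee_fin ln_ge0// ler_pdivlMr// mul1r rate_ge.
Qed.

Lemma rate_prod_cons rho s t : 0 <= rho -> {in s, forall y, y < t} ->
  rate_prod rho (conf (t :: s)) =
  rate_prod rho (conf s) * (rate rho (conf s) t / mu).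
Proof.
move=> rho0 st.
have past_t r : r <= t -> rate rho (conf (t :: s)) r = rate rho (conf s) r.
  move=> rt; rewrite /rate !excitation_conf big_cons past_le0 ?add0r//.
  by rewrite subr_le0.
rewrite !rate_prod_conf// big_cons past_t// mulrC; congr *%R.
rewrite [LHS]big_seq [RHS]big_seq; apply: eq_bigr => x /st/ltW xt.
by rewrite past_t.
Qed.

Lemma integral_excitation_le s b :
  (\int[leb]_(r in `]s0, b[) (excitation (conf s) r)%:E <= (size s)%:R%:E)%E.
Proof.
under eq_integral do rewrite excitation_conf -sumEFin.
rewrite ge0_integral_sum//.
- elim: s => [|x s ih]; first by rewrite big_nil.
  rewrite big_cons /= -natr1 addrC EFinD.
  by apply: leeD => //; exact: integral_past_le.
- move=> x; apply/measurable_EFinP/measurable_funTS; exact: measurable_past_comp.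
- by move=> x r _; rewrite lee_fin past_ge0.
Qed.

Lemma integral_rate_le rho s b : 0 <= rho -> s0 <= b ->
  (\int[leb]_(r in `]s0, b[) (rate rho (conf s) r)%:E <=
   (mu * (b - s0) + rho * (size s)%:R)%:E)%E.
Proof.
move=> rho0 s0b; under eq_integral do rewrite /rate EFinD EFinM.
have mE : measurable_fun `]s0, b[ (fun r => (excitation (conf s) r)%:E).
  apply/measurable_EFinP/measurable_funTS.
  by apply: (@measurable_excitation _ _ (fun=> conf s) id).
rewrite ge0_integralD//.
- rewrite integral_cst//= lebesgue_measure_itv/= lte_fin.
  rewrite EFinD EFinM; apply: leeD.
    have bs0 : 0 <= mu * (b - s0) by rewrite mulr_ge0 ?subr_ge0// ltW.
    by case: ifP => _; rewrite ?mule0 -?EFinB -?EFinM lee_fin.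
  rewrite ge0_integralZl_EFin//; last first.
    by move=> r _; rewrite lee_fin excitation_ge0.
  by rewrite EFinM lee_wpmul2l ?lee_fin// integral_excitation_le.
- by move=> r _; rewrite lee_fin ltW.
- by move=> r _; rewrite -EFinM lee_fin mulr_ge0// excitation_ge0.
- exact: emeasurable_funM.
Qed.

Lemma integral_rate_lty rho s b : 0 <= rho ->
  (\int[leb]_(r in `]s0, b[) (rate rho (conf s) r)%:E < +oo)%E.
Proof.
move=> rho0; have [s0b|bs0] := leP s0 b.
  by apply: le_lt_trans (integral_rate_le _ rho0 s0b) _; exact: ltry.
by rewrite set_itv_ge ?integral_set0 ?ltry// -leNgt bnd_simp ltW.
Qed.

Lemma prim_rate_le rho s b : 0 <= rho -> s0 <= b ->
  prim s0 (rate rho (conf s)) b <= mu * (b - s0) + rho * (size s)%:R.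
Proof.
move=> rho0 s0b; have := integral_rate_le s rho0 s0b.
have := integral_rate_lty s b rho0.
have : (0 <= \int[leb]_(r in `]s0, b[) (rate rho (conf s) r)%:E)%E.
  by apply: integral_ge0 => r _; rewrite lee_fin ltW// rate_gt0.
rewrite /prim /Rintegral.
by case: (\int[leb]_(r in _) _)%E => // r _ _; rewrite lee_fin.
Qed.

End hawkes_functionals.

(** * Locally finite simple counting measures are lists of points *)

Section configurations_of_paths.
Local Open Scope ereal_scope.
Context (R : realType).
Variable m : {measure set (measurableTypeR R) -> \bar R}.

Lemma measure_bigcup_nd_le (F : nat -> set (measurableTypeR R)) (c : \bar R) :
  (forall n, measurable (F n)) -> nondecreasing_seq F ->
  (forall n, m (F n) <= c) -> m (\bigcup_n F n) <= c.
Proof.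
move=> mF ndF Fc.
have cF := nondecreasing_cvg_mu (mu := m) mF (bigcupT_measurable _ mF) ndF.
rewrite -(cvg_lim _ cF)//; apply: lime_le; first by apply/cvg_ex; exists (m (\bigcup_n F n)).
exact: nearW.
Qed.

Lemma measure_left_le (s a : R) (c : \bar R) : 0 <= c ->
  (forall t, (s < t)%R -> (t < a)%R -> m `]s, t[%classic <= c) ->
  m `]s, a[%classic <= c.
Proof.
move=> c0 h.
have -> : `]s, a[%classic = \bigcup_n `]s, (a - n.+1%:R^-1)%R[%classic :> set R.
  apply/seteqP; split => [x|x [n _]]; rewrite /= !in_itv/=.
    move=> /andP[sx xa]; have /ltr_add_invr[n xna] := xa.
    by exists n => //; rewrite /= in_itv/= sx/= ltrBrDr.
  by move=> /andP[-> xa]; rewrite (lt_trans xa)// gtrBl invr_gt0.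
apply: measure_bigcup_nd_le => [n //|k n kn|n].
  apply/subsetPset/subset_itvl; rewrite bnd_simp lerB// lef_pV2 ?posrE//.
  by rewrite ler_nat.
have [sa|sa] := ltP s (a - n.+1%:R^-1)%R.
  by apply: h => //; rewrite gtrBl invr_gt0.
by rewrite set_itv_ge ?measure0// -leNgt bnd_simp.
Qed.

Lemma measure_right_le (a b : R) (c : \bar R) : 0 <= c ->
  (forall t, (a < t)%R -> (t < b)%R -> m `]t, b[%classic <= c) ->
  m `]a, b[%classic <= c.
Proof.
move=> c0 h.
have -> : `]a, b[%classic = \bigcup_n `](a + n.+1%:R^-1)%R, b[%classic :> set R.
  apply/seteqP; split => [x|x [n _]]; rewrite /= !in_itv/=.
    by move=> /andP[ax xb]; have /ltr_add_invr[n xna] := ax;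
      exists n => //; rewrite /= in_itv/= xna.
  by move=> /andP[xa ->]; rewrite (lt_trans _ xa)// ltrDl invr_gt0.
apply: measure_bigcup_nd_le => [n //|k n kn|n].
  apply/subsetPset/subset_itvr; rewrite bnd_simp lerD// lef_pV2 ?posrE//.
  by rewrite ler_nat.
have [sa|sa] := ltP (a + n.+1%:R^-1)%R b.
  by apply: h => //; rewrite ltrDl invr_gt0.
by rewrite set_itv_ge ?measure0// -leNgt bnd_simp.
Qed.

Lemma itv_oo_split (a b c : R) : (a < b)%R -> (b < c)%R ->
  `]a, c[%classic = `]a, b[ `|` ([set b] `|` `]b, c[) :> set R.
Proof.
move=> ab bc; apply/seteqP; split => x; rewrite /= !in_itv/=.
  by move=> /andP[ax xc]; case: (ltgtP x b); [left; rewrite ax|right;right|right;left].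
case=> [/andP[-> xb]|[->|/andP[bx ->]]].
- exact: lt_trans bc.
- by rewrite ab.
- by rewrite (lt_trans ab).
Qed.

Lemma measure_oo_split (a b c : R) (B : set (measurableTypeR R)) : measurable B ->
  (a < b)%R -> (b < c)%R ->
  m (B `&` `]a, c[) = m (B `&` `]a, b[) + (m (B `&` [set b]) + m (B `&` `]b, c[)).
Proof.
move=> mB ab bc; rewrite (itv_oo_split ab bc) !setIUr measureU; last 3 first.
- exact: measurableI.
- by apply: measurableU; exact: measurableI.
- apply/seteqP; split => x //= [[_]]; rewrite /= !in_itv/= => /andP[_ xb].
  by case=> -[_] => [xb'|/andP[bx _]]; [rewrite xb' ltxx in xb|
    rewrite ltNge ltW in xb].
congr (_ + _); rewrite measureU//.
- exact: measurableI.
- exact: measurableI.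
- by apply/seteqP; split => x //= [[_ ->]] [_]; rewrite /= in_itv/= ltxx.
Qed.

Hypothesis m_counting : locally_finite_counting m.
Hypothesis m_simple : forall t, m [set t] <= 1.

Lemma locally_finite_fin (a b : R) (B : set (measurableTypeR R)) : measurable B ->
  m (B `&` `]a, b[) \is a fin_num.
Proof.
move=> mB; have [|n ->//] := m_counting (a := a) (b := b) (measurableI _ _ mB (measurable_itv `]a, b[)).
by move=> x [_]; apply: subset_itvW.
Qed.

(** By induction on the number n + 1 of points in ]s, b[: the last point is the
supremum a of the times t such that ]s, t[ contains at most n points.  By
continuity along increasing unions, ]s, a[ contains at most n points and
]a, b[ none, so that a is a point, and a single one by simplicity. *)
Lemma path_configuration (s b : R) : exists s' : seq R,
  [/\ sorted >%R s', {in s', forall y, (s < y < b)%R} &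
    forall B, measurable B -> m (B `&` `]s, b[) = conf s' B].
Proof.
have [|n mn] := m_counting (a := s) (b := b) (measurable_itv `]s, b[).
  exact: subset_itvW.
elim: n b mn => [|n ih] b mn.
  exists [::]; split => // B mB; rewrite (_ : conf [::] B = 0)//.
  apply/eqP; rewrite -measure_le0.
  apply: (@le_trans _ _ (m `]s, b[%classic)); last by rewrite mn.
  by apply: le_measure; rewrite ?inE//; exact: measurableI.
have sb : (s < b)%R.
  rewrite ltNge; apply/negP => bs; move: mn; rewrite set_itv_ge -?leNgt ?bnd_simp//.
  by rewrite measure0 => -[] /eqP; rewrite eq_sym pnatr_eq0.
pose Z := [set t | (s <= t <= b)%R /\ m `]s, t[%classic <= n%:R%:E].
have Zs : Z s.
  by split; [rewrite lexx ltW|rewrite set_itvoo0 measure0 lee_fin].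
have Zub : has_ubound Z by exists b => t [/andP[_ ->]].
pose a := sup Z.
have sa : (s <= a)%R by exact: ub_le_sup.
have ab : (a <= b)%R by apply: ge_sup; [exists s|move=> t [/andP[_]]].
have ma : m `]s, a[%classic <= n%:R%:E.
  apply: measure_left_le => // t st ta.
  have [|z [_ zn] tz] := @sup_gt R Z t _ ta; first by exists s.
  apply: le_trans zn; apply: le_measure; rewrite ?inE//.
  by apply: subset_itvl; rewrite bnd_simp ltW.
have setTb x y : m (setT `&` `]x, y[) = m `]x, y[%classic by rewrite setTI.
have fin x y : m `]x, y[%classic \is a fin_num.
  by rewrite -setTb; apply: locally_finite_fin.
have fin1 x : m [set x] \is a fin_num.
  by rewrite ge0_fin_numE// (le_lt_trans (m_simple x)) ?ltry.
have split x : (s < x)%R -> (x < b)%R ->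
    n.+1%:R%:E = m `]s, x[%classic + (m [set x] + m `]x, b[%classic).
  move=> sx xb; rewrite -mn; have := measure_oo_split measurableT sx xb.
  by rewrite !setTI.
have after0 : m `]a, b[%classic <= 0.
  apply: measure_right_le => // t at' tb.
  have nZt : ~ Z t by move=> /(ub_le_sup Zub); rewrite leNgt at'.
  have : ~ (m `]s, t[%classic <= n%:R%:E).
    by move=> h; apply: nZt; split => //; rewrite (ltW (le_lt_trans sa at')) ltW.
  move=> /negP; rewrite -ltNge.
  have [|k mk] := m_counting (a := s) (b := t) (measurable_itv `]s, t[).
    exact: subset_itvW.
  have := split _ (le_lt_trans sa at') tb; rewrite mk lte_fin ltr_nat.
  rewrite -[m [set t]]fineK// -[m `]t, b[%classic]fineK//.
  have : (0 <= fine (m [set t]))%R by exact: fine_ge0.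
  have : (0 <= fine (m `]t, b[%classic))%R by exact: fine_ge0.
  move: (fine _) (fine _) => x y x0 y0 [] e nk.
  have : (n.+1%:R <= k%:R :> R)%R by rewrite ler_nat.
  by rewrite lee_fin; lra.
have {}after0 : m `]a, b[%classic = 0 by apply/eqP; rewrite -measure_le0.
have {}sa : (s < a)%R.
  rewrite lt_neqAle sa andbT; apply/eqP => sa'; move: after0; rewrite -sa' mn.
  by move=> [] /eqP; rewrite pnatr_eq0.
have {}ab : (a < b)%R.
  rewrite lt_neqAle ab andbT; apply/eqP => ab'; move: ma; rewrite ab' mn.
  by rewrite lee_fin ler_nat ltnn.
have := split a sa ab; rewrite after0 adde0.
have := m_simple a; move: ma.
have [|k mk] := m_counting (a := s) (b := a) (measurable_itv `]s, a[).
  exact: subset_itvW.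
rewrite mk.
have [|j mj] := m_counting (a := a) (b := a) (measurable_set1 (a : measurableTypeR R)).
  by move=> x ->; rewrite /= in_itv/= lexx.
rewrite mj !lee_fin -EFinD -natrD -[1%R]/(1%:R) !ler_nat => kn j1 [] /eqP.
rewrite eqr_nat => /eqP nkj.
have j1' : j = 1%N by lia.
have kn' : k = n by lia.
have [s' [ss' s'a ms']] := ih a ltac:(by rewrite mk kn').
exists (a :: s'); split.
- rewrite /= path_min_sorted//; apply/allP => y /s'a /andP[_ ya]//.
- move=> y; rewrite inE => /predU1P[->|/s'a/andP[-> ya]]; first by rewrite sa.
  exact: lt_trans ab.
- move=> B mB; rewrite (measure_oo_split mB sa ab) ms'// conf_cons addeC.
  congr (_ + _).
  have -> : m (B `&` `]a, b[) = 0.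
    apply/eqP; rewrite -measure_le0 -after0; apply: le_measure; rewrite ?inE//.
    exact: measurableI.
  rewrite adde0 indicE; have [aB|aB] := boolP (a \in B).
    rewrite (_ : B `&` [set a] = [set a]) ?mj ?j1'//.
    by apply/seteqP; split => [x []//|x ->]; split => //; exact: set_mem.
  rewrite (_ : B `&` [set a] = set0) ?measure0//.
  by apply/seteqP; split => // x [Bx xa]; move: aB; rewrite -xa mem_set.
Qed.

End configurations_of_paths.

(** * Functionals of the strict past are predictable *)

Section predictability.
Local Open Scope ereal_scope.
Context d (Omega : measurableType d) (R : realType).
Variables (N : R.-ker Omega ~> measurableTypeR R) (s0 : R).

Local Notation D := ([set: Omega] `*` `]s0, +oo[).

(** Predictable sets form a sigma-algebra of subsets of Omega * ]s0, +oo[ only;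
traces on that set let predictability be handled as measurability on the whole
product. *)
Definition predictable_trace : set_system (Omega * R) :=
  [set A | predictable_sets (natural_filtration N) s0 (D `&` A)].

Lemma predictable_trace_sigma : sigma_algebra setT predictable_trace.
Proof.
split.
- by rewrite /predictable_trace/= setI0; exact: sigma_algebra0.
- move=> A mA; rewrite /predictable_trace/= setTD.
  have -> : D `&` ~` A = D `\` (D `&` A).
    by apply/seteqP; split => x /= [] //; tauto.
  exact: sigma_algebraCD.
- move=> F mF; rewrite /predictable_trace/= setI_bigcupr.
  exact: sigma_algebra_bigcup.
Qed.

Local Notation PT := (g_sigma_algebraType predictable_trace).

Lemma predictable_traceE (A : set PT) : measurable A <-> predictable_trace A.
Proof.
by rewrite measurable_g_measurableTypeE//; exact: predictable_trace_sigma.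
Qed.

Lemma predictable_rect (q : R) (A : set Omega) : (s0 <= q)%R ->
  natural_filtration N q A -> predictable_trace (A `*` `]q, +oo[).
Proof.
move=> s0q mA; rewrite /predictable_trace/=.
have -> : D `&` A `*` `]q, +oo[ = \bigcup_n (A `*` `]q, (q + n.+1%:R)%R]).
  apply/seteqP; split => -[w t] /=; rewrite !in_itv/= !andbT.
    move=> [[_ _] [Aw qt]]; exists (Num.trunc (t - q)) => //=; split => //.
    rewrite in_itv/= qt/=.
    have /andP[_] : ((Num.trunc (t - q))%:R <= t - q < (Num.trunc (t - q)).+1%:R)%R.
      by rewrite truncn_itv// subr_ge0 ltW.
    by move=> /ltW; lra.
  move=> [n _ [/= Aw]]; rewrite in_itv/= => /andP[qt _].
  by split; [split => //; exact: le_lt_trans qt|split].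
apply: sigma_algebra_bigcup => n; apply: sub_sigma_algebra.
by exists q, (q + n.+1%:R)%R, A; split => //; rewrite ltrDl.
Qed.

Definition strict_past (z : Omega * R) : config R * R :=
  (restriction N (measurable_itv `]s0, z.2[) z.1, z.2).

(** Points are counted on the open interval ]s0, t[, so the number of points of
B exceeds x strictly before t exactly when it already does so on ]s0, q] for
some rational q < t: the event is a countable union of predictable
rectangles. *)
Lemma measurable_strict_past : measurable_fun [set: PT] (strict_past : PT -> config R * R).
Proof.
apply: measurable_fun_pair; last first.
  apply: (@measurability _ _ PT (measurableTypeR R) setT _ (@RGenOInfty.G R)).
    exact: RGenOInfty.measurableE.
  move=> _ [_ [x ->] <-]; apply/predictable_traceE.
  have := @predictable_rect (Num.max x s0) setT.
  rewrite le_max lexx orbT => /(_ isT); rewrite /predictable_trace/= setTI.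
  have -> : D `&` [set: Omega] `*` `]Num.max x s0, +oo[ =
      D `&` ((fun z : Omega * R => z.2) @^-1` `]x, +oo[).
    apply/seteqP; split => -[w t] /=; rewrite !in_itv/= !andbT gt_max.
      by move=> [[_ ?] [_ /andP[]]].
    by move=> [[_ st] xt]; rewrite st xt.
  apply; rewrite -(setD0 setT); apply: sigma_algebraCD.
  exact: sigma_algebra0.
apply: measurable_config => B mB.
apply: (@measurability _ _ PT _ setT _ (@ErealGenOInfty.G R)).
  exact: ErealGenOInfty.measurableE.
move=> _ [_ [x ->] <-]; rewrite setTI.
have -> : (fun z : PT => restriction N (measurable_itv `]s0, z.2[) z.1 B) @^-1`
    `]x%:E, +oo[ = [set z : PT | x%:E < N z.1 (B `&` `]s0, z.2[)].
  by apply/seteqP; split => z; rewrite /= in_itv/= andbT.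
apply/predictable_traceE; rewrite /predictable_trace/=.
pose A (q : rat) := [set w | x%:E < N w (B `&` `]s0, ratr q])].
have -> : D `&` [set z | x%:E < N z.1 (B `&` `]s0, z.2[)] =
    D `&` \bigcup_(q : rat) (if (s0 <= ratr q)%R then
      A q `*` `]ratr q, +oo[ else set0).
  apply/seteqP; split => -[w t] /= [[_]]; rewrite in_itv/= andbT => st.
    move=> xN; split => //.
    apply: contrapT => nq; move: xN; rewrite ltNge => /negP; apply.
    have [x0|x0] := ltP x 0%R.
      exfalso; have [q] := rat_in_itvoo st; rewrite in_itv/= => /andP[sq qt].
      apply: nq; exists q => //; rewrite (ltW sq); split; last by rewrite /= in_itv/= qt.
      by rewrite /A/=; apply: (@lt_le_trans _ _ 0).
    pose mB' : {measure set (measurableTypeR R) -> \bar R} := mrestr (N w) mB.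
    rewrite setIC; apply: (@measure_left_le R mB') => // r sr rt.
    rewrite leNgt; apply/negP => xr.
    have [q] := rat_in_itvoo rt; rewrite in_itv/= => /andP[rq qt].
    apply: nq; exists q => //; rewrite (ltW (lt_trans sr rq)).
    split; last by rewrite /= in_itv/= qt.
    rewrite /A/=; apply: (lt_le_trans xr); apply: le_measure; rewrite ?inE.
    - exact: measurableI.
    - exact: measurableI.
    - rewrite setIC; apply: setIS; apply: subset_itvl; rewrite bnd_simp.
      exact: ltW.
  move=> [q _]; case: ifPn => // sq [/= xA]; rewrite in_itv/= andbT => qt.
  split; first by split => //; rewrite in_itv/= st.
  apply: (lt_le_trans xA); apply: le_measure; rewrite ?inE.
  - exact: measurableI.
  - exact: measurableI.
  - by apply: setIS; apply: subset_itvl; rewrite bnd_simp.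
rewrite -/(predictable_trace _).
apply/predictable_traceE; apply: bigcupT_measurable_rat => q.
case: ifPn => // sq; apply/predictable_traceE; apply: predictable_rect => //.
apply: sub_sigma_algebra; exists (B `&` `]s0, ratr q]).
  split; first exact: measurableI.
  by move=> y [_ /=]; rewrite !in_itv/= => /andP[].
exists `]x%:E, +oo[%classic; first exact: emeasurable_itv.
by rewrite setTI; apply/seteqP; split => w; rewrite /A /= in_itv/= andbT.
Qed.

Lemma predictable_past (c : config R * R -> \bar R) :
  measurable_fun setT c ->
  predictable (natural_filtration N) s0 (fun z => c (strict_past z)).
Proof.
move=> mc U mU; have := measurableT_comp mc measurable_strict_past.
move=> /(_ measurableT U mU); rewrite setTI => h.
exact/predictable_traceE.
Qed.

End predictability.

(** * Intensity identity for configurations *)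

Section restriction_integrals.
Local Open Scope ereal_scope.
Context (R : realType).

(** Two configurations may agree on measurable sets without being equal, since
measures are functions on all sets; events generated by evaluations at
measurable sets do not separate them. *)
Lemma measurable_config_ext (F : config R -> \bar R) (xi xi' : config R) :
  measurable_fun setT F -> (forall B, measurable B -> xi B = xi' B) ->
  F xi = F xi'.
Proof.
move=> mF h.
suff ext V : measurable V -> V xi <-> V xi'.
  have FV := mF measurableT _ (emeasurable_set1 (F xi)); rewrite setTI in FV.
  by have [/(_ erefl) /= ->] := ext _ FV.
apply: (@smallest_sub _ (sigma_algebra setT) (@evaluation_sets _ (measurableTypeR R) R)
  [set V : set (config R) | V xi <-> V xi']); first split => //.
- by move=> A /= [AB BA]; split => -[_ nA]; split => // ?; apply: nA; [exact: BA|exact: AB].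
- move=> A /= hA; split => -[i _ Ai]; exists i => //; exact/(hA i).
- by move=> _ [B mB [Y mY <-]]; rewrite setTI /= /evaluation h.
Qed.

Lemma integral_mrestr d (T : measurableType d) (m : {measure set T -> \bar R})
    (D : set T) (mD : measurable D) (f : T -> \bar R) :
  measurable_fun setT f -> (forall x, 0 <= f x) ->
  \int[mrestr m mD]_x f x = \int[m]_(x in D) f x.
Proof.
move=> mf f0; rewrite -(setUv D) ge0_integral_setU//=.
- rewrite [X in _ + X](_ : _ = 0) ?adde0.
    apply: eq_measure_integral => A mA AD; rewrite /= /mrestr.
    by rewrite setIidl.
  rewrite -(integral_measure_zero (~` D) f).
  apply: eq_measure_integral => A mA AD; rewrite /= /mrestr /mzero.
  rewrite (_ : A `&` D = set0) ?measure0//.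
  by apply/seteqP; split => // x [/AD].
- exact: measurableC.
- by rewrite setUv.
- by apply/disj_setPCl.
Qed.

End restriction_integrals.

(** The intensity identity for integrands that see a configuration only through
its points before the current time, all that the change of law needs of the
underlying filtration.  Every outcome, not just almost every one, is a list of
points, so that pathwise statements are proved by induction on lists. *)
Definition has_intensity d (Omega : measurableType d) (R : realType)
    (P : probability Omega R) (s0 T : R) (X : Omega -> config R)
    (lambda : config R -> R -> R) : Prop :=
  [/\ measurable_fun setT X,
      forall w, exists s : seq R, [/\ sorted >%R s,
        {in s, forall y, s0 < y < T} & X w = conf s]
    & forall c : config R * R -> \bar R, measurable_fun setT c ->
        (forall z, 0 <= c z)%E ->
        (\int[P]_w \int[X w]_t c (before t (X w), t) =
         \int[P]_w \int[lebesgue_measure]_(t in `]s0, T[)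
           (c (before t (X w), t) * (lambda (X w) t)%:E))%E].

Section hawkes_has_intensity.
Local Open Scope ereal_scope.
Context d (Omega : measurableType d) (R : realType) (P : probability Omega R).
Variables (N : R.-ker Omega ~> measurableTypeR R).
Variables (mu rho s0 T : R) (g : R -> R).
Hypotheses (mu_gt0 : (0 < mu)%R) (rho_ge0 : (0 <= rho)%R).
Hypothesis g_shape : kernel_shape g.
Hypothesis hawkes : linear_hawkes mu rho g s0 P N.
Local Notation leb := (@lebesgue_measure R).
Local Notation I := (`]s0, T[%classic).
Local Notation X0 := (restriction N (measurable_itv `]s0, T[)).

Let N_counting w : locally_finite_counting (N w).
Proof. by have [[]] := hawkes. Qed.

Let X0_fin w : fin_part (X0 w) = X0 w.
Proof.
rewrite /fin_part; have -> : X0 w [set: R] < +oo => //.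
have := @locally_finite_fin _ _ (@N_counting w) s0 T _ measurableT.
by rewrite ge0_fin_numE.
Qed.

Let mX0 : measurable_fun setT X0. Proof. exact: measurable_funP. Qed.

Let integral_X0 w (f : R -> \bar R) : measurable_fun setT f ->
  (forall x, 0 <= f x) -> \int[X0 w]_x f x = \int[N w]_(x in I) f x.
Proof. by move=> mf f0; exact: integral_mrestr. Qed.

Section test_function.
Variable c : config R * R -> \bar R.
Hypotheses (mc : measurable_fun setT c) (c_ge0 : forall z, 0 <= c z).

(* Both sides of the intensity identity as measurable functionals of the
   configuration alone, so that a modification of it preserves their means. *)
Let jumps (xi : config R) : \bar R :=
  \int[fin_part xi]_t (if (s0 < t < T)%R then c (before t xi, t) else 0).

Let drift (xi : config R) : \bar R :=
  \int[leb]_(t in I) (c (before t xi, t) *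
    (mu%:E + rho%:E * \int[fin_part xi]_x (past g (t - x))%:E)).

Let mcut : measurable_fun setT
  (fun z : config R * measurableTypeR R => c (before z.2 z.1, z.2)).
Proof.
apply: (measurableT_comp mc); apply: measurable_fun_pair.
  by apply: measurable_before; [exact: measurable_fst|exact: measurable_snd].
exact: measurable_snd.
Qed.

Let mcut_time xi : measurable_fun setT (fun t : measurableTypeR R => c (before t xi, t)).
Proof. exact: (measurable_fun_pair2 xi mcut). Qed.

Let measurable_jumps : measurable_fun setT jumps.
Proof.
apply: (@measurable_fin_part_integral _ _ (config R) id _
  (fun z => if (s0 < z.2 < T)%R then c (before z.2 z.1, z.2) else 0)) => //.
  by move=> z; case: ifP.
apply: measurable_fun_ifT => //; apply: measurable_and;
  by apply: measurable_fun_ltr => //; exact: measurable_snd.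
Qed.

Let measurable_drift : measurable_fun setT drift.
Proof.
apply: (measurable_itv_integral (h := fun z => c (before z.2 z.1, z.2) *
    (mu%:E + rho%:E * \int[fin_part z.1]_x (past g (z.2 - x))%:E))) => //.
  move=> z; rewrite mule_ge0// adde_ge0//; first by rewrite lee_fin ltW.
  rewrite mule_ge0 ?lee_fin// integral_ge0// => x _.
  by rewrite lee_fin past_ge0.
apply: emeasurable_funM => //; apply: emeasurable_funD => //.
apply: emeasurable_funM => //.
have m1 : measurable_fun setT (fun z : config R * measurableTypeR R => z.1).
  exact: measurable_fst.
apply: (measurable_fin_part_integral m1 (h := fun z => (past g (z.1.2 - z.2))%:E)).
- by move=> z; rewrite lee_fin past_ge0.
- apply/measurable_EFinP; apply: measurable_past_comp => //.
  by apply: measurableT_comp; [exact: measurable_snd|exact: measurable_fst].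
Qed.

Let c_past w t : (t < T)%R ->
  c (restriction N (measurable_itv `]s0, t[) w, t) = c (before t (X0 w), t).
Proof.
move=> tT; apply: (measurable_config_ext (F := fun xi => c (xi, t))).
  by apply: measurableT_comp => //; exact: pair2_measurable.
move=> B mB; rewrite /restriction /before X0_fin /= /mrestr -setIA; congr (N w _).
congr (_ `&` _); apply/seteqP; split => x /=; rewrite !in_itv/=.
  by move=> /andP[-> xt]; rewrite xt (lt_trans xt).
by move=> [-> /andP[->]].
Qed.

Let hawkes_past w t : (t < T)%R -> hawkes_intensity mu rho g N s0 w t =
  mu%:E + rho%:E * \int[fin_part (X0 w)]_x (past g (t - x))%:E.
Proof.
move=> tT; rewrite /hawkes_intensity X0_fin integral_X0; last 2 first.
- by apply/measurable_EFinP; apply: measurable_past_comp.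
- by move=> x; rewrite lee_fin past_ge0.
congr (_ + _ * _); rewrite [LHS]integral_mkcond [RHS]integral_mkcond.
apply: eq_integral => x _; rewrite !patchE !mem_setE !in_itv/= /past subr_gt0.
have [xt|tx] := ltP x t; first by rewrite (lt_trans xt tT).
by rewrite andbF; case: ifP.
Qed.

(* Cutting the integrand at T restricts the identity to the window ]s0, T[. *)
Let c' (z : config R * R) := if (z.2 < T)%R then c z else 0.

Let c'_ge0 z : 0 <= c' z. Proof. by rewrite /c'; case: ifP. Qed.

Let jumpsE w :
  \int[N w]_(t in `]s0, +oo[) c' (strict_past N s0 (w, t)) = jumps (X0 w).
Proof.
rewrite /jumps X0_fin integral_X0.
- rewrite [LHS]integral_mkcond [RHS]integral_mkcond.
  apply: eq_integral => t _; rewrite !patchE !mem_setE !in_itv/= andbT /c'/=.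
  by case: ltP => // st; case: ltP => // tT; rewrite c_past.
- apply: measurable_fun_ifT => //.
    by apply: measurable_and; apply: measurable_fun_ltr.
  exact: mcut_time.
- by move=> t; case: ifP.
Qed.

Let driftE w : \int[leb]_(t in `]s0, +oo[)
  (c' (strict_past N s0 (w, t)) * hawkes_intensity mu rho g N s0 w t) = drift (X0 w).
Proof.
rewrite /drift [LHS]integral_mkcond [RHS]integral_mkcond.
apply: eq_integral => t _; rewrite !patchE !mem_setE !in_itv/= andbT /c'/=.
by case: ltP => // st; case: ltP => tT; rewrite ?mul0e// c_past// hawkes_past.
Qed.

Let intensity_X0 : \int[P]_w jumps (X0 w) = \int[P]_w drift (X0 w).
Proof.
have [_ [_ _ _ /(_ (fun z => c' (strict_past N s0 z)))]] := hawkes.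
have mc' : measurable_fun setT c'.
  by apply: measurable_fun_ifT => //; apply: measurable_fun_ltr.
move=> /(_ (fun w t _ => c'_ge0 _) (predictable_past mc')) e.
transitivity (\int[P]_w \int[N w]_(t in `]s0, +oo[) c' (strict_past N s0 (w, t))).
  by apply: eq_integral => w _; rewrite jumpsE.
by rewrite e; apply: eq_integral => w _; exact: driftE.
Qed.

Lemma intensity_modification (X : Omega -> config R) :
  measurable_fun setT X ->
  {ae P, forall w, forall B, measurable B -> X w B = X0 w B} ->
  (forall w, exists s : seq R,
    {in s, forall y, (s0 < y < T)%R} /\ X w = conf s) ->
  \int[P]_w \int[X w]_t c (before t (X w), t) =
  \int[P]_w \int[leb]_(t in I)
    (c (before t (X w), t) * (rate mu g rho (X w) t)%:E).
Proof.
move=> mX XX0 Xconf.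
have drift_ge0 xi : 0 <= drift xi.
  apply: integral_ge0 => t _; rewrite mule_ge0// adde_ge0//.
    by rewrite lee_fin ltW.
  rewrite mule_ge0 ?lee_fin// integral_ge0// => x _.
  by rewrite lee_fin past_ge0.
have jumps_ge0 xi : 0 <= jumps xi.
  by apply: integral_ge0 => t _; case: ifP.
have ae_X (F : config R -> \bar R) : measurable_fun setT F -> (forall xi, 0 <= F xi) ->
    \int[P]_w F (X0 w) = \int[P]_w F (X w).
  move=> mF F0; apply: ge0_ae_eq_integral => //.
  - exact: measurableT_comp.
  - exact: measurableT_comp.
  - apply: filterS XX0 => w h _; apply: measurable_config_ext => // B mB.
    by rewrite h.
have e := etrans (etrans (esym (ae_X _ measurable_jumps jumps_ge0)) intensity_X0)
  (ae_X _ measurable_drift drift_ge0).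
have -> : \int[P]_w \int[X w]_t c (before t (X w), t) = \int[P]_w jumps (X w).
  apply: eq_integral => w _; have [s [sT ->]] := Xconf w.
  rewrite /jumps fin_part_conf !integral_conf.
  - rewrite [LHS]big_seq [RHS]big_seq; apply: eq_bigr => x /sT ->.
    by [].
  - apply: measurable_fun_ifT => //.
    by apply: measurable_and; apply: measurable_fun_ltr.
  - by move=> t; case: ifP.
  - exact: mcut_time.
  - by [].
rewrite e; apply: eq_integral => w _; have [s [sT ->]] := Xconf w.
apply: eq_integral => t _; congr (_ * _); rewrite /rate EFinD EFinM.
congr (_ + _ * _); rewrite /excitation fineK// fin_part_conf integral_conf.
- by rewrite sumEFin.
- by apply/measurable_EFinP; apply: measurable_past_comp.
- by move=> x; rewrite lee_fin past_ge0.
Qed.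

End test_function.

(** Outside the negligible set where the process is not simple, the points in
the window are listed by [path_configuration]; on that set the empty list is
taken.  Lists are chosen pointwise without regard to measurability: the
resulting configuration is measurable because it agrees with the restricted
process on measurable sets. *)
Lemma hawkes_modification : exists X : Omega -> config R,
  has_intensity P s0 T X (rate mu g rho) /\
  {ae P, forall w, forall B, measurable B -> X w B = X0 w B}.
Proof.
have [[_ _ [A [mA A0 Asimple]]] _] := hawkes.
have simple w : ~ A w -> forall t, N w [set t] <= 1.
  by move=> Aw; apply: contrapT => h; apply: Aw; exact: Asimple.
pose points w : seq R := if pselect (A w) is right nA
  then sval (cid (@path_configuration R (N w) (@N_counting w) (simple w nA) s0 T))
  else [::].
have pointsP w : [/\ sorted >%R (points w),
    {in points w, forall y, (s0 < y < T)%R} &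
    forall B, measurable B -> conf (points w) B = if w \in A then 0 else X0 w B].
  rewrite /points; case: pselect => [Aw|nA].
    by split => // B mB; rewrite mem_set.
  case: cid => s /= [ss sT sN]; split => // B mB.
  by rewrite memNset//= -sN.
exists (fun w => conf (points w)); split; last first.
  exists A; split => // w nX; apply: contrapT => nA; apply: nX => B mB.
  by have [_ _ ->//] := pointsP w; rewrite memNset.
have mX : measurable_fun setT (fun w => conf (points w)).
  apply: measurable_config => B mB.
  have -> : (fun w => conf (points w) B) = (fun w => if w \in A then 0 else X0 w B).
    by apply/funext => w; have [_ _ ->] := pointsP w.
  apply: measurable_fun_ifT => //; last exact: measurable_comp_eval.
  apply: (@measurable_fun_bool _ _ _ _ true); rewrite setTI.
  by rewrite (_ : _ @^-1` _ = A)//; apply/seteqP; split => w; [exact: set_mem|exact: mem_set].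
split => //.
  by move=> w; have [ss sT _] := pointsP w; exists (points w).
move=> c mc c0; apply: intensity_modification => //.
  exists A; split => // w nX; apply: contrapT => nA; apply: nX => B mB.
  by have [_ _ ->//] := pointsP w; rewrite memNset.
by move=> w; have [_ sT _] := pointsP w; exists (points w).
Qed.

End hawkes_has_intensity.

(** * Weights that remove the dependence on the branching ratio *)

Lemma measurable_inv_gt0 d (X : measurableType d) (R : realType) (f : X -> R) :
  (forall x, 0 < f x) -> measurable_fun setT f ->
  measurable_fun setT (fun x => (f x)^-1).
Proof.
move=> f0 mf; have -> : (fun x => (f x)^-1) = fun x => expR (- ln (f x)).
  by apply/funext => x; rewrite expRN lnK// posrE.
by apply: measurableT_comp => //; apply: measurableT_comp => //;
  exact: measurableT_comp.
Qed.

Section sums_over_points.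
Context (R : realType).
Implicit Types (s : seq R).

Lemma measurable_before_time d (U : measurableType d)
    (c : config R * R -> U) (xi : config R) :
  measurable_fun setT c -> measurable_fun setT (fun t : R => c (before t xi, t)).
Proof.
move=> mc; apply: (measurableT_comp mc); apply: measurable_fun_pair => //.
exact: (@measurable_before R _ _ (fun=> xi) id).
Qed.

Lemma integral_before_conf (c : config R * R -> \bar R) s :
  measurable_fun setT c -> (forall z, 0 <= c z)%E ->
  (\int[conf s]_t c (before t (conf s), t) =
   \sum_(x <- s) c (conf [seq y <- s | (y < x)%R], x))%E.
Proof.
move=> mc c0; rewrite integral_conf//; last exact: measurable_before_time.
by apply: eq_bigr => x _; rewrite before_conf.
Qed.

(** The points preceded by fewer than n others are the n oldest ones. *)
Lemma sum_rank_lt s n : sorted >%R s ->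
  (\sum_(x <- s) (size [seq y <- s | (y < x)%R] < n)%N = minn (size s) n)%N.
Proof.
elim: s => [|x s ih]; first by rewrite big_nil min0n.
move=> /sorted_gt_cons[ss sx]; rewrite big_cons filter_lt_cons_le// filter_lt_id//.
rewrite (_ : (\sum_(j <- s) _)%N = minn (size s) n) /=; last first.
  rewrite -ih// [LHS]big_seq [RHS]big_seq; apply: eq_bigr => j /sx jx.
  by rewrite ltNge (ltW jx).
by case: ltnP; lia.
Qed.

End sums_over_points.

Section expectations.
Local Open Scope ereal_scope.
Context d (Omega : measurableType d) (R : realType) (P : probability Omega R).

Lemma bounded_mean_fin_num (J : Omega -> \bar R) (C : R) :
  measurable_fun setT J -> (forall w, 0 <= J w) -> (forall w, J w <= C%:E) ->
  \int[P]_w J w \is a fin_num.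
Proof.
move=> mJ J0 JC; rewrite ge0_fin_numE; last exact: integral_ge0.
apply: (@le_lt_trans _ _ (\int[P]_w C%:E)).
  by apply: ge0_le_integral.
by rewrite (integral_cst P measurableT) [X in _ * X]probability_setT mule1 ltry.
Qed.

(** Taking means in a pathwise identity between nonnegative terms, where the
jump term J and its compensator D occur on opposite sides; they may be
cancelled because their common mean is finite. *)
Lemma cancel_compensated_mean (h : R) (A D Y J : Omega -> \bar R) : (0 <= h)%R ->
  measurable_fun setT A -> measurable_fun setT D ->
  measurable_fun setT Y -> measurable_fun setT J ->
  (forall w, 0 <= A w) -> (forall w, 0 <= D w) ->
  (forall w, 0 <= Y w) -> (forall w, 0 <= J w) ->
  (forall w, h%:E + A w + D w = Y w + J w) ->
  \int[P]_w J w = \int[P]_w D w -> \int[P]_w J w \is a fin_num ->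
  \int[P]_w Y w = h%:E + \int[P]_w A w.
Proof.
move=> h0 mA mD mY mJ A0 D0 Y0 J0 E JD Jfin.
rewrite -[LHS](addeK _ Jfin) -[RHS](addeK _ Jfin); congr (_ - _).
rewrite -ge0_integralD// [in RHS]JD.
rewrite (eq_integral (fun w => h%:E + A w + D w)); last by move=> w _; rewrite E.
rewrite ge0_integralD//; last 2 first.
- by move=> w _; rewrite adde_ge0// lee_fin.
- exact: emeasurable_funD.
rewrite ge0_integralD//.
by rewrite (integral_cst P measurableT) [X in _ * X]probability_setT mule1.
Qed.

End expectations.

Section path_functionals.
Context d (Omega : measurableType d) (R : realType) (P : probability Omega R).
Variables (mu rho s0 T : R) (g : R -> R) (X : Omega -> config R).
Hypotheses (mu_gt0 : 0 < mu) (rho_ge0 : 0 <= rho).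
Hypothesis g_shape : kernel_shape g.
Hypothesis X_intensity : has_intensity P s0 T X (rate mu g rho).
Local Notation leb := (@lebesgue_measure R).
Local Notation lam := (rate mu g rho).

Let mX : measurable_fun setT X. Proof. by case: X_intensity. Qed.

Lemma measurable_jump_integral (c : config R * R -> \bar R) :
  measurable_fun setT c -> (forall z, 0 <= c z)%E ->
  measurable_fun setT (fun w => \int[X w]_t c (before t (X w), t))%E.
Proof.
move=> mc c0.
have -> : (fun w => \int[X w]_t c (before t (X w), t))%E =
    (fun w => \int[fin_part (X w)]_t c (before t (X w), t))%E.
  apply/funext => w; have [_ /(_ w)[s [_ _ ->]] _] := X_intensity.
  by rewrite fin_part_conf.
have m1 : measurable_fun setT (fun z : Omega * measurableTypeR R => X z.1).
  by apply: measurableT_comp => //; exact: measurable_fst.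
apply: (measurable_fin_part_integral mX (h := fun z => c (before z.2 (X z.1), z.2))) => //.
apply: (measurableT_comp mc); apply: measurable_fun_pair; last exact: measurable_snd.
by apply: measurable_before => //; exact: measurable_snd.
Qed.

Lemma measurable_compensator (c : config R * R -> \bar R) :
  measurable_fun setT c -> (forall z, 0 <= c z)%E ->
  measurable_fun setT (fun w => \int[leb]_(t in `]s0, T[)
    (c (before t (X w), t) * (lam (X w) t)%:E))%E.
Proof.
move=> mc c0.
have m1 : measurable_fun setT (fun z : Omega * measurableTypeR R => X z.1).
  by apply: measurableT_comp => //; exact: measurable_fst.
apply: (measurable_itv_integral (h := fun z =>
  c (before z.2 (X z.1), z.2) * (lam (X z.1) z.2)%:E)%E) => //.
- by move=> z; rewrite mule_ge0// lee_fin ltW// rate_gt0.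
- apply: emeasurable_funM.
    apply: (measurableT_comp mc); apply: measurable_fun_pair; last exact: measurable_snd.
    by apply: measurable_before => //; exact: measurable_snd.
  by apply/measurable_EFinP; apply: measurable_rate => //; exact: measurable_snd.
Qed.

End path_functionals.

Section density_recursion.
Context d (Omega : measurableType d) (R : realType) (P : probability Omega R).
Variables (mu rho s0 T : R) (g : R -> R) (X : Omega -> config R).
Hypotheses (mu_gt0 : 0 < mu) (rho_ge0 : 0 <= rho).
Hypothesis g_shape : kernel_shape g.
Hypothesis X_intensity : has_intensity P s0 T X (rate mu g rho).
Local Notation leb := (@lebesgue_measure R).
Local Notation lam := (rate mu g rho).
Local Notation Lam := (fun xi t => prim s0 (rate mu g rho xi) t).
Local Notation W := (rate_prod mu g rho).

(** The mean of H over the points before u, after the weights 1 / density have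
removed the intensity of the process.  Its value turns out not to depend on
rho ([weighted_eq]). *)
Definition weighted (H : config R -> R) (u : R) : \bar R :=
  \int[P]_w (expR (Lam (X w) u) * (H (before u (X w)) / W (before u (X w))))%:E.

Variables (H : config R -> R) (K : R) (n : nat) (u : R).
Hypothesis mH : measurable_fun setT H.
Hypothesis H_ge0 : forall xi, 0 <= H xi.
Hypothesis H_le : forall xi, H xi <= K.
Hypothesis H_small : forall s, (n <= size s)%N -> H (conf s) = 0.
Hypotheses (s0u : s0 <= u) (uT : u <= T).

Let G xi := H xi / W xi.

Let G_ge0 xi : 0 <= G xi.
Proof. by rewrite divr_ge0// ltW// rate_prod_gt0. Qed.

(* The terms of [path_identity] at a jump, with the points after u cut off. *)
Let before_jump (z : config R * R) : \bar R :=
  (if z.2 < u then expR (Lam z.1 z.2) * G z.1 else 0)%:E.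

Let after_jump (z : config R * R) : \bar R :=
  (if z.2 < u then expR (Lam z.1 z.2) * G (add_point z.1 z.2) else 0)%:E.

Let before_jumpE xi t :
  before_jump (xi, t) = (if t < u then expR (Lam xi t) * G xi else 0)%:E.
Proof. by []. Qed.

Let after_jumpE xi t : after_jump (xi, t) =
  (if t < u then expR (Lam xi t) * G (add_point xi t) else 0)%:E.
Proof. by []. Qed.

Let mG d' (Y : measurableType d') (p : Y -> config R) : measurable_fun setT p ->
  measurable_fun setT (fun y => G (p y)).
Proof.
move=> mp; apply: measurable_funM; first exact: measurableT_comp.
apply: measurable_inv_gt0 => [y|]; first exact: rate_prod_gt0.
exact: measurable_rate_prod.
Qed.

Let mLam d' (Y : measurableType d') (p : Y -> config R) (v : Y -> R) :
  measurable_fun setT p -> measurable_fun setT v ->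
  measurable_fun setT (fun y => expR (Lam (p y) (v y))).
Proof.
by move=> mp mv; apply: measurableT_comp => //; exact: measurable_prim_rate.
Qed.

Let mbefore_jump : measurable_fun setT before_jump.
Proof.
apply/measurable_EFinP; apply: measurable_fun_ifT => //.
  by apply: measurable_fun_ltr => //; exact: measurable_snd.
apply: measurable_funM; last exact: (mG measurable_fst).
exact: mLam.
Qed.

Let mafter_jump : measurable_fun setT after_jump.
Proof.
apply/measurable_EFinP; apply: measurable_fun_ifT => //.
  by apply: measurable_fun_ltr => //; exact: measurable_snd.
apply: measurable_funM; first exact: mLam.
by apply: mG; apply: measurable_add_point.
Qed.

Let before_jump_ge0 z : (0 <= before_jump z)%E.
Proof. by rewrite lee_fin; case: ifP => // _; rewrite mulr_ge0// expR_ge0. Qed.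

Let after_jump_ge0 z : (0 <= after_jump z)%E.
Proof. by rewrite lee_fin; case: ifP => // _; rewrite mulr_ge0// expR_ge0. Qed.

Let pathwise w :
  ((G (conf [::]))%:E + \int[X w]_t after_jump (before t (X w), t) +
   \int[leb]_(t in `]s0, T[)
     (before_jump (before t (X w), t) * (lam (X w) t)%:E) =
   (expR (Lam (X w) u) * G (before u (X w)))%:E +
   \int[X w]_t before_jump (before t (X w), t))%E.
Proof.
have [_ /(_ w)[s [ss sT ->]] _] := X_intensity.
pose s' := [seq y <- s | y < u].
have ss' : sorted >%R s'.
  by apply: sorted_filter => // x y z yx xz; exact: lt_trans yx.
have s'u : {in s', forall y, s0 < y < u}.
  by move=> y; rewrite mem_filter => /andP[yu /sT/andP[-> _]].
have lam_ge0 t : 0 <= lam (conf s) t by rewrite ltW// rate_gt0.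
have mlam : measurable_fun setT (lam (conf s)) by exact: measurable_rate_time.
have lam_fin t : (\int[leb]_(r in `]s0, t[) (lam (conf s) r)%:E < +oo)%E.
  exact: integral_rate_lty.
have L0 : Lam (conf s) s0 = 0 by rewrite /prim set_itvoo0 Rintegral_set0.
have id := path_identity lam_ge0 mlam
  (measurable_prim lam_ge0 mlam lam_fin) L0
  (integral_expR_prim lam_ge0 mlam lam_fin)
  (fun s => G_ge0 (conf s)) ss' s'u s0u.
rewrite !integral_before_conf//.
have past_filter t : t <= u -> [seq y <- s' | y < t] = [seq y <- s | y < t].
  move=> tu; rewrite -filter_predI; apply: eq_filter => y /=.
  by case: ltP => //= yt; rewrite (lt_le_trans yt).
have e1 : (\sum_(x <- s) after_jump (conf [seq y <- s | (y < x)%R], x) =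
    (\sum_(x <- s') expR (Lam (conf s) x) * G (conf (x :: [seq y <- s' | y < x])))%:E)%E.
  rewrite -sumEFin big_filter [RHS]big_mkcond/=; apply: eq_bigr => x _.
  rewrite after_jumpE; case: ifP => [xu|_]; last by [].
  rewrite add_point_conf prim_rate_before; last exact: g_shape.
  congr (_ * G (conf (_ :: _)))%:E; exact/esym/past_filter/ltW.
have e2 : (\sum_(x <- s) before_jump (conf [seq y <- s | (y < x)%R], x) =
    (\sum_(x <- s') expR (Lam (conf s) x) * G (conf [seq y <- s' | y < x]))%:E)%E.
  rewrite -sumEFin big_filter [RHS]big_mkcond/=; apply: eq_bigr => x _.
  rewrite before_jumpE; case: ifP => [xu|_]; last by [].
  rewrite prim_rate_before//.
  congr (_ * G (conf _))%:E; exact/esym/past_filter/ltW.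
rewrite e1 e2 before_conf -/s' -!EFinD -id EFinD; congr (_ + _)%E.
rewrite [LHS]integral_mkcond [RHS]integral_mkcond; apply: eq_integral => t _.
rewrite !patchE !mem_setE !in_itv/= before_jumpE.
case: ltP => //= _; case: (ltP t u) => tu; last first.
  by case: ifP => //; rewrite mul0e.
rewrite (lt_le_trans tu uT) before_conf prim_rate_before//.
have <- : conf [seq y <- s' | y < t] = conf [seq y <- s | y < t].
  by congr conf; exact/past_filter/ltW.
by rewrite -EFinM; congr EFin; ring.
Qed.

Let mX : measurable_fun setT X. Proof. by case: X_intensity. Qed.

(** H vanishes on configurations of n points or more, so only the n oldest
points contribute, and before each of them the compensator is bounded. *)
Let before_jump_le w : (\int[X w]_t before_jump (before t (X w), t) <=
  (expR (mu * (u - s0) + rho * n%:R) * K * n%:R)%:E)%E.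
Proof.
have [_ /(_ w)[s [ss sT ->]] _] := X_intensity.
rewrite integral_before_conf//.
set C := expR _ * K.
have C0 : 0 <= C.
  by rewrite mulr_ge0 ?expR_ge0//; exact: le_trans (H_ge0 (conf [::])) (H_le _).
have term x : x \in s -> (before_jump (conf [seq y <- s | (y < x)%R], x) <=
    (C * (size [seq y <- s | (y < x)%R] < n)%N%:R)%:E)%E.
  move=> xs; rewrite before_jumpE lee_fin; set s' := [seq y <- s | y < x].
  have [sn|ns] := ltnP (size s') n; last first.
    by rewrite /G H_small// mul0r !mulr0; case: ifP.
  rewrite mulr1; case: ifP => // xu.
  rewrite /C; apply: ler_pM; [exact: expR_ge0|exact: G_ge0| |].
    rewrite ler_expR.
    have s0x : s0 <= x by have /andP[/ltW] := sT x xs.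
    apply: le_trans (prim_rate_le mu_gt0 g_shape s' rho_ge0 s0x) _.
    apply: lerD.
      by rewrite ler_wpM2l ?(ltW mu_gt0)// lerB// ltW.
    by rewrite ler_wpM2l// ler_nat ltnW.
  apply: le_trans (H_le (conf s')).
  by rewrite ler_pdivrMr ?rate_prod_gt0// ler_peMr// rate_prod_ge1.
apply: (@le_trans _ _ (\sum_(x <- s) (C * (size [seq y <- s | (y < x)%R] < n)%N%:R)%:E)%E).
  by rewrite [leLHS]big_seq [leRHS]big_seq; apply: lee_sum => x /term.
rewrite sumEFin lee_fin -mulr_sumr -natr_sum sum_rank_lt//.
by rewrite ler_wpM2l// ler_nat geq_minr.
Qed.

Let measurable_at_u : measurable_fun setT
  (fun w => (expR (Lam (X w) u) * G (before u (X w)))%:E).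
Proof.
apply/measurable_EFinP; apply: measurable_funM; first exact: mLam.
by apply: mG; exact: measurable_before.
Qed.

(** The rate lambda (t) at which a point t appears cancels against the factor
lambda (t) / mu that this point adds to the product. *)
Let jump_rate w t : s0 < t -> t < T ->
  (after_jump (before t (X w), t) * (lam (X w) t)%:E =
   (if (t < u)%R then mu * (expR (Lam (X w) t) *
     (H (add_point (before t (X w)) t) / W (before t (X w)))) else 0)%:E)%E.
Proof.
move=> s0t tT; rewrite after_jumpE; case: ifP => tu; last by rewrite mul0e.
have [_ /(_ w)[s [_ _ ->]] _] := X_intensity.
rewrite -EFinM; congr EFin; rewrite before_conf add_point_conf.
rewrite prim_rate_before; last exact: g_shape.
rewrite /G rate_prod_cons//; last by move=> y; rewrite mem_filter => /andP[].
rewrite (rate_before _ g_shape _ _ (lexx t)).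
have := rate_gt0 mu_gt0 g_shape (conf s) t rho_ge0.
have := rate_prod_gt0 mu g rho (conf [seq y <- s | y < t]).
move: (lam _ _) (W _) (expR _) (H _) => a b e h b0 a0.
by field; rewrite !gt_eqF.
Qed.

Let mean_after_jump : (\int[P]_w \int[X w]_t after_jump (before t (X w), t) =
  \int[leb]_(t in `]s0, u[)
     (mu%:E * weighted (fun xi => H (add_point xi t)) t))%E.
Proof.
have [_ _ ->//] := X_intensity.
pose h (z : Omega * measurableTypeR R) : \bar R := (if s0 < z.2 < u then
  mu * (expR (Lam (X z.1) z.2) *
   (H (add_point (before z.2 (X z.1)) z.2) / W (before z.2 (X z.1)))) else 0)%:E.
transitivity (\int[P]_w \int[leb]_t h (w, t))%E.
  apply: eq_integral => w _; rewrite integral_mkcond; apply: eq_integral => t _.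
  rewrite patchE mem_setE in_itv/= /h/=.
  case: (ltP s0 t) => //= s0t; case: (ltP t T) => tT; first by rewrite jump_rate.
  by rewrite ltNge (le_trans uT tT).
have h0 z : (0 <= h z)%E.
  rewrite lee_fin; case: ifP => // _; rewrite mulr_ge0 ?(ltW mu_gt0)//.
  by rewrite mulr_ge0 ?expR_ge0// divr_ge0// ltW// rate_prod_gt0.
have m1 : measurable_fun setT (fun z : Omega * measurableTypeR R => X z.1).
  by apply: measurableT_comp => //; exact: measurable_fst.
have mbef : measurable_fun setT
    (fun z : Omega * measurableTypeR R => before z.2 (X z.1)).
  by apply: measurable_before => //; exact: measurable_snd.
have mh : measurable_fun setT h.
  apply/measurable_EFinP; apply: measurable_fun_ifT => //.
    by apply: measurable_and; apply: measurable_fun_ltr => //; exact: measurable_snd.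
  apply: measurable_funM => //; apply: measurable_funM; first exact: mLam.
  apply: measurable_funM.
    by apply: (measurableT_comp mH); apply: measurable_add_point.
  apply: measurable_inv_gt0 => [y|]; first exact: rate_prod_gt0.
  exact: measurable_rate_prod.
rewrite (fubini_tonelli h)// [RHS]integral_mkcond; apply: eq_integral => t _.
rewrite patchE mem_setE in_itv/= /h/=; case: ifP => _; last by rewrite integral0.
rewrite /weighted; under eq_integral do rewrite EFinM.
apply: ge0_integralZl_EFin; last exact: ltW; first exact: measurableT.
- move=> w _; rewrite lee_fin mulr_ge0 ?expR_ge0// divr_ge0// ltW//.
  exact: rate_prod_gt0.
- apply/measurable_EFinP; apply: measurable_funM; first exact: mLam.
  have mb : measurable_fun setT (fun w => before t (X w)) by exact: measurable_before.
  apply: measurable_funM.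
    by apply: (measurableT_comp mH); apply: measurable_add_point.
  apply: measurable_inv_gt0 => [y|]; first exact: rate_prod_gt0.
  exact: measurable_rate_prod.
Qed.

(** The mean of [path_identity].  The terms at the strict past cancel against
the growth of the exponential by the intensity identity, and the same identity
turns the terms after a jump into an integral over time, in which
[jump_rate] leaves no trace of rho. *)
Lemma weighted_rec : weighted H u =
  ((H (conf [::]))%:E + \int[leb]_(t in `]s0, u[)
     (mu%:E * weighted (fun xi => H (add_point xi t)) t))%E.
Proof.
have [_ _ intensity] := X_intensity.
have G0 : G (conf [::]) = H (conf [::]).
  by rewrite /G rate_prod_conf// big_nil divr1.
rewrite -mean_after_jump -G0.
have mJ := measurable_jump_integral X_intensity mbefore_jump before_jump_ge0.
apply: (cancel_compensated_mean (G_ge0 _)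
  (measurable_jump_integral X_intensity mafter_jump after_jump_ge0)
  (measurable_compensator mu_gt0 rho_ge0 g_shape X_intensity
    mbefore_jump before_jump_ge0) measurable_at_u mJ
  _ _ _ _ pathwise (intensity before_jump mbefore_jump before_jump_ge0)).
- by move=> w; apply: integral_ge0 => t _; exact: after_jump_ge0.
- move=> w; apply: integral_ge0 => t _; rewrite mule_ge0// lee_fin ltW//.
  exact: rate_gt0.
- by move=> w; rewrite lee_fin mulr_ge0// expR_ge0.
- by move=> w; apply: integral_ge0 => t _; exact: before_jump_ge0.
- refine (bounded_mean_fin_num P mJ _ before_jump_le).
  by move=> w; apply: integral_ge0 => t _; exact: before_jump_ge0.
Qed.

End density_recursion.

Section reference_measure.
Context (R : realType) d0 d1 (Omega0 : measurableType d0)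
  (Omega1 : measurableType d1) (P0 : probability Omega0 R)
  (P1 : probability Omega1 R).
Variables (mu rho0 rho1 s0 T : R) (g : R -> R).
Variables (X0 : Omega0 -> config R) (X1 : Omega1 -> config R).
Hypotheses (mu_gt0 : 0 < mu) (rho0_ge0 : 0 <= rho0) (rho1_ge0 : 0 <= rho1).
Hypothesis g_shape : kernel_shape g.
Hypothesis X0_intensity : has_intensity P0 s0 T X0 (rate mu g rho0).
Hypothesis X1_intensity : has_intensity P1 s0 T X1 (rate mu g rho1).

(** Unfolding the recursion n times reaches functionals that vanish on every
finite configuration. *)
Lemma weighted_eq n (H : config R -> R) (K u : R) :
  measurable_fun setT H -> (forall xi, 0 <= H xi) -> (forall xi, H xi <= K) ->
  (forall s, (n <= size s)%N -> H (conf s) = 0) -> s0 <= u -> u <= T ->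
  weighted P0 mu rho0 s0 g X0 H u = weighted P1 mu rho1 s0 g X1 H u.
Proof.
elim: n H u => [|n ih] H u mH H0 HK Hsmall s0u uT.
  have zero d (Omega : measurableType d) (P : probability Omega R) rho
      (X : Omega -> config R) : has_intensity P s0 T X (rate mu g rho) ->
      weighted P mu rho s0 g X H u = 0%E.
    move=> [_ Xconf _]; rewrite /weighted -[RHS](integral0 P setT).
    apply: eq_integral => w _; have [s [_ _ ->]] := Xconf w.
    by rewrite before_conf Hsmall// mul0r mulr0.
  by rewrite (zero _ _ _ _ _ X0_intensity) (zero _ _ _ _ _ X1_intensity).
rewrite (weighted_rec mu_gt0 rho0_ge0 g_shape X0_intensity mH H0 HK Hsmall)//.
rewrite (weighted_rec mu_gt0 rho1_ge0 g_shape X1_intensity mH H0 HK Hsmall)//.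
congr (_ + _)%E; apply: eq_integral => t; rewrite inE/= in_itv/= => /andP[s0t tu].
congr (_ * _)%E; apply: ih => //.
- by apply: (measurableT_comp mH); exact: measurable_add_point.
- by move=> s ns; rewrite add_point_conf Hsmall.
- exact: ltW.
- exact: le_trans (ltW tu) uT.
Qed.

End reference_measure.

(** * Entropy bound from a likelihood ratio *)

Section relative_entropy_bound.
Local Open Scope ereal_scope.
Context d d' (Omega : measurableType d) (U : measurableType d') (R : realType).
Variables (P : probability Omega R) (Q : probability U R).
Variables (Z : {mfun Omega >-> U}) (L : Omega -> R).
Hypothesis L_gt0 : forall w, (0 < L w)%R.
Hypothesis mL : measurable_fun setT L.
Hypothesis change_law : forall h : U -> \bar R, measurable_fun setT h ->
  (forall y, 0 <= h y) -> \int[Q]_y h y = \int[P]_w (h (Z w) * (L w)%:E).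

Let law_dominated : distribution P Z `<< Q.
Proof.
apply/null_content_dominatesP => B mB QB.
have mZB : measurable (Z @^-1` B).
  by rewrite -[X in measurable X]setTI; exact: measurable_funPT.
have := change_law (h := EFin \o \1_B).
rewrite integral_indic// setIT QB => /(_ _ _)/esym.
have m1 : measurable_fun setT (EFin \o \1_B : U -> \bar R).
  by apply/measurable_EFinP; exact: measurable_indic.
move=> /(_ m1 (fun y => _)) e0.
have {}e0 : \int[P]_w `|(\1_B (Z w))%:E * (L w)%:E| = 0.
  rewrite -e0; last by move=> y; rewrite lee_fin.
  apply: eq_integral => w _; rewrite gee0_abs// mule_ge0// lee_fin//.
  exact: ltW.
have mBL : measurable_fun setT (fun w => (\1_B (Z w))%:E * (L w)%:E).
  apply: emeasurable_funM; last exact/measurable_EFinP.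
  by apply: (measurableT_comp m1); exact: measurable_funPT.
have /ae_eq_integral_abs := e0; move=> /(_ measurableT mBL) [A [mA A0 subA]].
change (P (Z @^-1` B) = 0).
apply: (subset_measure0 mZB mA _ A0).
move=> w /= ZwB; apply: subA => /= /(_ I) /eqP.
by rewrite indicE mem_set// mul1e eqe gt_eqF.
Qed.

Let f : U -> \bar R :=
  Radon_Nikodym (charge_of_finite_measure (distribution P Z)) Q.

Let f_fin y : f y \is a fin_num.
Proof. by rewrite /f; apply: Radon_Nikodym_fin_num. Qed.

Let mf : measurable_fun setT f.
Proof. by rewrite /f; apply: measurable_int; apply: Radon_Nikodym_integrable. Qed.

(* The Radon-Nikodym derivative is nonnegative only almost everywhere. *)
Let phi y : R := Num.max (fine (f y)) 0%R.

Let phi_ge0 y : (0 <= phi y)%R. Proof. by rewrite le_max lexx orbT. Qed.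

Let mphi : measurable_fun setT phi.
Proof.
apply: measurable_maxr => //.
exact: (measurableT_comp (@fine_measurable R setT measurableT)).
Qed.

Let mean_phi : \int[P]_w ((phi (Z w))%:E * (L w)%:E) <= 1.
Proof.
rewrite -(change_law (h := EFin \o phi)); last 2 first.
- exact/measurable_EFinP.
- by move=> y; rewrite lee_fin.
have mB : measurable [set y | 0 <= f y].
  by rewrite -[X in measurable X]setTI; apply: emeasurable_fun_c_infty.
have -> : \int[Q]_y (EFin \o phi) y = \int[Q]_(y in [set y | 0 <= f y]) f y.
  rewrite [RHS]integral_mkcond; apply: eq_integral => y _.
  rewrite patchE /phi /=; case: (leP 0 (f y)) => h.
    by rewrite mem_set// max_l ?fineK// fine_ge0.
  rewrite memNset; last by rewrite /= leNgt h.
  by rewrite max_r// fine_le0// ltW.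
rewrite /f -Radon_Nikodym_integral//.
exact: probability_le1.
Qed.

Let log_density y : \bar R := lne (f y).

Let mlog_density : measurable_fun setT log_density.
Proof.
have -> : log_density = fun y =>
    if f y <= 0 then -oo else (ln (fine (f y)))%:E.
  apply/funext => y; rewrite /log_density; have := f_fin y.
  by case: (f y) => // r _; rewrite /= lee_fin.
apply: measurable_fun_ifT => //.
  apply: (@measurable_fun_bool _ _ _ _ true).
  exact: emeasurable_fun_infty_c.
apply/measurable_EFinP; apply: measurableT_comp => //.
exact: (measurableT_comp (@fine_measurable R setT measurableT)).
Qed.

Variables (V1 V2 : Omega -> \bar R) (C : R).
Hypotheses (mV1 : measurable_fun setT V1) (mV2 : measurable_fun setT V2).
Hypotheses (V1_ge0 : forall w, 0 <= V1 w) (V2_ge0 : forall w, 0 <= V2 w).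
(* The bound V1 - V2 on - log L is kept as two nonnegative parts, so that no
   integrability of log L has to be known. *)
Hypothesis log_L_le : forall w, (- ln (L w))%:E + V2 w <= V1 w.
Hypothesis V2_fin : \int[P]_w V2 w < +oo.
Hypothesis V1_le : \int[P]_w V1 w <= \int[P]_w V2 w + C%:E.

(* log x <= x - 1 at x = phi * L. *)
Let pointwise w : log_density^\+ (Z w) + (V2 w + 1) <=
  V1 w + ((phi (Z w))%:E * (L w)%:E) + log_density^\- (Z w).
Proof.
rewrite funeposE funenegE /log_density /phi.
have := f_fin (Z w); case: (f (Z w)) => // r _; rewrite /=.
case: (leP r 0%R) => r0.
  have -> : maxe (- -oo) 0%R = +oo :> \bar R by rewrite max_l// leey.
  by rewrite mul0e adde0 addey ?leey// gt_eqF// (@lt_le_trans _ _ 0).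
have Lw := L_gt0 w.
have key : (ln r)%:E + (V2 w + 1) <= V1 w + (r%:E * (L w)%:E).
  have -> : (ln r)%:E + (V2 w + 1) =
      ((- ln (L w))%:E + V2 w) + (ln (r * L w) + 1)%:E.
    rewrite lnM ?posrE// addeA addeAC -EFinD [in RHS]addeAC -EFinD addeC.
    by rewrite [LHS]addeC; congr (_%:E + _); ring.
  apply: leeD => //; rewrite -EFinM lee_fin -lerBrDr.
  have e : (1 + (r * L w - 1) = r * L w)%R by ring.
  have := @le_ln1Dx R (r * L w - 1)%R; rewrite e; apply.
  by rewrite ltrBrDr addrC subrr mulr_gt0.
have -> : maxe (ln r)%:E 0 = (ln r)%:E + maxe (- (ln r)%:E) 0.
  rewrite -EFinN -!EFin_max -EFinD; congr EFin.
  by case: (leP (ln r) 0%R) => h; [rewrite max_l|rewrite max_r]; lra.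
by rewrite addeAC leeD.
Qed.

Let mZ (h : U -> \bar R) : measurable_fun setT h ->
  measurable_fun setT (fun w => h (Z w)).
Proof. by move=> mh; apply: (measurableT_comp mh); exact: measurable_funPT. Qed.

Let integrated :
  \int[P]_w log_density^\+ (Z w) + (\int[P]_w V2 w + 1) <=
  \int[P]_w V1 w + 1 + \int[P]_w log_density^\- (Z w).
Proof.
have mpos := mZ (measurable_funepos mlog_density).
have mneg := mZ (measurable_funeneg mlog_density).
have mphiL : measurable_fun setT (fun w => (phi (Z w))%:E * (L w)%:E).
  apply: emeasurable_funM; last exact/measurable_EFinP.
  by apply: (mZ (h := EFin \o phi)); exact/measurable_EFinP.
have phiL_ge0 w : 0 <= (phi (Z w))%:E * (L w)%:E.
  by rewrite mule_ge0// lee_fin// ltW.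
have one_ge0 : 0 <= 1 :> \bar R by [].
have -> : \int[P]_w V2 w + 1 = \int[P]_w (V2 w + 1).
  rewrite ge0_integralD// (integral_cst P measurableT).
  by rewrite [X in _ = _ + _ * X]probability_setT mule1.
rewrite -ge0_integralD//; last 2 first.
- by move=> w _; rewrite adde_ge0.
- exact: emeasurable_funD.
apply: (@le_trans _ _ (\int[P]_w
    (V1 w + (phi (Z w))%:E * (L w)%:E + log_density^\- (Z w)))).
  apply: ge0_le_integral => //.
  - by move=> w _; rewrite adde_ge0// adde_ge0.
  - by apply: emeasurable_funD => //; exact: emeasurable_funD.
  - by apply: emeasurable_funD => //; exact: emeasurable_funD.
rewrite ge0_integralD//; last 2 first.
- by move=> w _; rewrite adde_ge0.
- exact: emeasurable_funD.
by rewrite leeD2r// ge0_integralD// leeD2l.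
Qed.

(** Integrating [pointwise], where E (phi * L) <= 1 cancels the constant one.
The observation Z may forget part of the outcome: only means of functions of
Z enter the change of law. *)
Lemma KL_le_log_bound : KL (distribution P Z) Q <= C%:E.
Proof.
rewrite /KL; case: asboolP => // _.
change (\int[distribution P Z]_y log_density y <= C%:E).
have mpos := measurable_funepos mlog_density.
have mneg := measurable_funeneg mlog_density.
rewrite integralE !ge0_integral_distribution//.
change (\int[P]_w log_density^\+ (Z w) - \int[P]_w log_density^\- (Z w) <= C%:E).
have := integrated.
have : 0 <= \int[P]_w log_density^\+ (Z w) by exact: integral_ge0.
have : 0 <= \int[P]_w log_density^\- (Z w) by exact: integral_ge0.
have : 0 <= \int[P]_w V2 w by exact: integral_ge0.
have : 0 <= \int[P]_w V1 w by exact: integral_ge0.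
move: V2_fin V1_le.
move: (\int[P]_w V1 w) (\int[P]_w V2 w) (\int[P]_w log_density^\+ (Z w))
  (\int[P]_w log_density^\- (Z w)) => v1 v2 a b.
case: v2 => // v2 _; case: v1 => // v1; case: b => [b||] //; last first.
  by rewrite addeNy leNye.
case: a => // a; rewrite -!EFinD -?EFinB !lee_fin => *; lra.
Qed.

End relative_entropy_bound.

(** * Density of one Hawkes law with respect to another *)

Section truncation.
Local Open Scope ereal_scope.
Context (R : realType).

Lemma mine_natr_cvg (x : \bar R) : 0 <= x ->
  mine x n%:R%:E @[n --> \oo] --> x.
Proof.
case: x => [r r0||//].
  apply: cvg_near_cst; exists (Num.trunc r).+1 => // n /= rn.
  rewrite min_l// lee_fin; have /andP[_ /ltW h] := truncn_itv (r0 : (0 <= r)%R).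
  by apply: (le_trans h); rewrite ler_nat.
move=> _; rewrite (_ : (fun n => _) = fun n : nat => n%:R%:E).
  by apply/cvgeryP; exact: cvgr_idn.
by apply/funext => n; rewrite min_r// leey.
Qed.

Variable F : config R -> \bar R.
Hypotheses (mF : measurable_fun setT F) (F_ge0 : forall xi, 0 <= F xi).

(** A nondecreasing approximation of F by functionals that are bounded and
vanish on large configurations, as the recursion on weights requires. *)
Definition truncate (n : nat) (xi : config R) : R :=
  if xi [set: R] < n%:R%:E then fine (mine (F xi) n%:R%:E) else 0%R.

Lemma truncateE n xi : (truncate n xi)%:E =
  if xi [set: R] < n%:R%:E then mine (F xi) n%:R%:E else 0.
Proof.
rewrite /truncate; case: ifP => // _; rewrite fineK//.
rewrite ge0_fin_numE; first by rewrite (@le_lt_trans _ _ n%:R%:E) ?ltry// ge_min lexx orbT.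
by rewrite le_min F_ge0 lee_fin/=.
Qed.

Lemma truncate_ge0 n xi : (0 <= truncate n xi)%R.
Proof.
rewrite -lee_fin truncateE; case: ifP => // _.
by rewrite le_min F_ge0 lee_fin/=.
Qed.

Lemma truncate_le n xi : (truncate n xi <= n%:R)%R.
Proof. by rewrite -lee_fin truncateE; case: ifP => // _; rewrite ge_min lexx orbT. Qed.

Lemma truncate_conf n s : (n <= size s)%N -> truncate n (conf s) = 0%R.
Proof. by move=> ns; rewrite /truncate conf_setT lte_fin ltr_nat ltnNge ns. Qed.

Lemma measurable_truncate n : measurable_fun setT (truncate n).
Proof.
apply/measurable_EFinP.
rewrite (_ : _ \o _ = fun xi : config R =>
  if xi [set: R] < n%:R%:E then mine (F xi) n%:R%:E else 0); last first.
  by apply/funext => xi; exact: truncateE.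
apply: measurable_fun_ifT => //.
  apply: (@measurable_fun_bool _ _ _ _ true).
  by apply: emeasurable_fun_infty_o => //; exact: measurable_eval.
exact: measurable_mine.
Qed.

Lemma truncate_nd xi : {homo truncate ^~ xi : n m / (n <= m)%N >-> (n <= m)%R}.
Proof.
move=> n m nm; rewrite -lee_fin !truncateE.
have nmR : n%:R%:E <= m%:R%:E :> \bar R by rewrite lee_fin ler_nat.
case: ifPn => xn.
  by rewrite (lt_le_trans xn nmR) le_min !ge_min lexx nmR orbT.
by case: ifP => // _; rewrite le_min F_ge0 lee_fin/=.
Qed.

Lemma truncate_cvg s : (truncate n (conf s))%:E @[n --> \oo] --> F (conf s).
Proof.
apply: cvg_trans (mine_natr_cvg (F_ge0 (conf s))).
apply: near_eq_cvg; exists (size s).+1 => // n /= sn.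
by rewrite truncateE conf_setT lte_fin ltr_nat sn.
Qed.

Lemma integral_truncate_cvg d (Omega : measurableType d)
    (P : probability Omega R) (X : Omega -> config R) (k : Omega -> R) :
  measurable_fun setT X -> (forall w, exists s, X w = conf s) ->
  measurable_fun setT k -> (forall w, (0 <= k w)%R) ->
  \int[P]_w (truncate n (X w) * k w)%R%:E @[n --> \oo] -->
  \int[P]_w (F (X w) * (k w)%:E).
Proof.
move=> mX Xconf mk k0.
have limE w : F (X w) * (k w)%:E =
    limn (fun n => (truncate n (X w) * k w)%R%:E).
  have [s ->] := Xconf w; apply/esym/cvg_lim => //.
  under eq_fun do rewrite EFinM.
  by apply: cvgeZr => //; exact: truncate_cvg.
rewrite (eq_integral _ _ (fun w _ => limE w)).
apply: (@cvg_monotone_convergence _ _ _ P setT measurableT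
  (fun n w => (truncate n (X w) * k w)%R%:E)).
- move=> n; apply/measurable_EFinP; apply: measurable_funM => //.
  by apply: (measurableT_comp (measurable_truncate n)).
- by move=> n w _; rewrite lee_fin mulr_ge0// truncate_ge0.
- by move=> w _ n m nm; rewrite lee_fin ler_wpM2r// truncate_nd.
Qed.

End truncation.

Section change_of_law.
Context (R : realType) d0 d1 (Omega0 : measurableType d0)
  (Omega1 : measurableType d1) (P0 : probability Omega0 R)
  (P1 : probability Omega1 R).
Variables (mu rho0 rho1 s0 T : R) (g : R -> R).
Variables (X0 : Omega0 -> config R) (X1 : Omega1 -> config R).
Hypotheses (mu_gt0 : 0 < mu) (rho0_ge0 : 0 <= rho0) (rho1_ge0 : 0 <= rho1).
Hypothesis g_shape : kernel_shape g.
Hypothesis s0T : s0 <= T.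
Hypothesis X0_intensity : has_intensity P0 s0 T X0 (rate mu g rho0).
Hypothesis X1_intensity : has_intensity P1 s0 T X1 (rate mu g rho1).

Definition dens rho (xi : config R) : R :=
  rate_prod mu g rho xi * expR (- prim s0 (rate mu g rho xi) T).

Lemma dens_gt0 rho xi : 0 < dens rho xi.
Proof. by rewrite mulr_gt0 ?expR_gt0// rate_prod_gt0. Qed.

Lemma measurable_dens rho : 0 <= rho -> measurable_fun setT (dens rho).
Proof.
move=> rho_ge0; apply: measurable_funM.
  exact: (@measurable_rate_prod R mu g mu_gt0 g_shape _ _ id).
apply: (measurableT_comp (@measurable_expR R)).
apply: measurableT_comp => //.
exact: (@measurable_prim_rate R mu s0 g mu_gt0 g_shape _ _ id (fun=> T)).
Qed.

Lemma weighted_dens d (Omega : measurableType d) (P : probability Omega R)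
    (X : Omega -> config R) rho (H : config R -> R) :
  has_intensity P s0 T X (rate mu g rho) ->
  (weighted P mu rho s0 g X H T = \int[P]_w (H (X w) * (dens rho (X w))^-1)%:E)%E.
Proof.
move=> [_ Xconf _]; apply: eq_integral => w _; congr EFin.
have [s [_ sT ->]] := Xconf w.
rewrite before_conf filter_lt_id; last by move=> y /sT/andP[].
by rewrite /dens invfM expRN invrK; ring.
Qed.

(** Apply [weighted_eq] to truncations of F * dens rho1: dividing by dens rho1
gives F under the second law, dividing by dens rho0 gives F * dens rho1 /
dens rho0 under the first one. *)
Lemma change_of_law (F : config R -> \bar R) :
  measurable_fun setT F -> (forall xi, 0 <= F xi)%E ->
  (\int[P1]_w F (X1 w) =
   \int[P0]_w (F (X0 w) * (dens rho1 (X0 w) / dens rho0 (X0 w))%:E))%E.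
Proof.
move=> mF F0.
have mdF : measurable_fun setT (fun xi => F xi * (dens rho1 xi)%:E)%E.
  by apply: emeasurable_funM => //; apply/measurable_EFinP; exact: measurable_dens.
have dF0 xi : (0 <= F xi * (dens rho1 xi)%:E)%E.
  by rewrite mule_ge0// lee_fin ltW// dens_gt0.
have cvg_dens d (Omega : measurableType d) (P : probability Omega R)
    (X : Omega -> config R) rho : 0 <= rho ->
    has_intensity P s0 T X (rate mu g rho) ->
    (weighted P mu rho s0 g X
       (truncate (fun xi => F xi * (dens rho1 xi)%:E) n) T @[n --> \oo] -->
     \int[P]_w (F (X w) * (dens rho1 (X w))%:E * (dens rho (X w))^-1%:E))%E.
  move=> rho_ge0 Xint; have [mX Xconf _] := Xint.
  under eq_fun do rewrite (weighted_dens _ Xint).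
  apply: (@integral_truncate_cvg R _ mdF dF0 _ _ P X (fun w => (dens rho (X w))^-1)) => //.
  - by move=> w; have [s [_ _ ->]] := Xconf w; exists s.
  - apply: measurable_inv_gt0 => [w|]; first exact: dens_gt0.
    by apply: (measurableT_comp (measurable_dens rho_ge0)).
  - by move=> w; rewrite invr_ge0 ltW// dens_gt0.
have c0 := cvg_dens _ _ _ _ _ rho0_ge0 X0_intensity.
have c1 := cvg_dens _ _ _ _ _ rho1_ge0 X1_intensity.
have e : (fun n => weighted P1 mu rho1 s0 g X1
     (truncate (fun xi => F xi * (dens rho1 xi)%:E)%E n) T) =
   (fun n => weighted P0 mu rho0 s0 g X0
     (truncate (fun xi => F xi * (dens rho1 xi)%:E)%E n) T).
  apply/funext => n; apply/esym.
  apply: (weighted_eq mu_gt0 rho0_ge0 rho1_ge0 g_shape X0_intensity X1_intensity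
    (measurable_truncate mdF dF0 n) (truncate_ge0 dF0 n) (truncate_le dF0 n)) => //.
  by move=> s; exact: truncate_conf.
rewrite e in c1.
have := cvg_unique _ c1 c0 => e'.
transitivity (\int[P1]_w (F (X1 w) * (dens rho1 (X1 w))%:E * (dens rho1 (X1 w))^-1%:E))%E.
  apply: eq_integral => w _; rewrite -muleA -EFinM mulfV ?mule1//.
  by rewrite gt_eqF// dens_gt0.
rewrite e'//; apply: eq_integral => w _.
by rewrite -muleA -EFinM.
Qed.

End change_of_law.

(** * Mean number of points *)

Section mean_number_of_points.
Local Open Scope ereal_scope.
Context d (Omega : measurableType d) (R : realType) (P : probability Omega R).
Variables (mu rho s0 T : R) (g : R -> R) (X : Omega -> config R).
Hypotheses (mu_gt0 : (0 < mu)%R) (rho_ge0 : (0 <= rho)%R) (rho_lt1 : (rho < 1)%R).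
Hypothesis g_shape : kernel_shape g.
Hypothesis s0T : (s0 <= T)%R.
Hypothesis X_intensity : has_intensity P s0 T X (rate mu g rho).
Local Notation leb := (@lebesgue_measure R).

(* Counting only the k oldest points keeps all means finite, which the
   comparison m <= mu * (T - s0) + rho * m needs to bound m. *)
Let few (k : nat) (z : config R * R) : \bar R :=
  if z.1 [set: R] < k%:R%:E then 1 else 0.

Let measurable_few k : measurable_fun setT (few k).
Proof.
apply: measurable_fun_ifT => //.
apply: (@measurable_fun_bool _ _ _ _ true).
apply: emeasurable_fun_infty_o => //.
exact: (measurable_comp_eval measurable_fst).
Qed.

Let few_ge0 k z : 0 <= few k z. Proof. by rewrite /few; case: ifP. Qed.

Let few_jumps k w :
  \int[X w]_t few k (before t (X w), t) = mine (X w [set: R]) k%:R%:E.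
Proof.
have [_ /(_ w)[s [ss _ ->]] _] := X_intensity.
rewrite integral_before_conf// conf_setT -EFin_min -natr_min minEnat.
rewrite -(sum_rank_lt _ ss) natr_sum -sumEFin; apply: eq_bigr => x _.
by rewrite /few/= conf_setT lte_fin ltr_nat; case: ltnP.
Qed.

(** While fewer than k points have occurred, the points seen so far are all
among the k oldest ones; each of them contributes at most rho to the integral
of the intensity since g has mass one. *)
Let few_drift k w :
  \int[leb]_(t in `]s0, T[) (few k (before t (X w), t) * (rate mu g rho (X w) t)%:E)
  <= (mu * (T - s0))%:E + rho%:E * mine (X w [set: R]) k%:R%:E.
Proof.
have [_ /(_ w)[s [ss _ ->]] _] := X_intensity.
pose young x : R := (size [seq y <- s | (y < x)%R] < k)%N%:R.
have mp x : measurable_fun `]s0, T[ (fun t => past g (t - x)).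
  by apply: measurable_funTS; exact: measurable_past_comp.
have mpx x : measurable_fun `]s0, T[ (fun t => (past g (t - x))%:E).
  exact/measurable_EFinP.
have myp x : measurable_fun `]s0, T[ (fun t => (young x * past g (t - x))%:E).
  by apply/measurable_EFinP; apply: measurable_funM.
have yp_ge0 x t : 0 <= (young x * past g (t - x))%:E.
  by rewrite lee_fin mulr_ge0// past_ge0.
apply: (@le_trans _ _ (\int[leb]_(t in `]s0, T[)
    (mu%:E + rho%:E * \sum_(x <- s) (young x * past g (t - x))%:E))).
  apply: ge0_le_integral => //.
  - move=> t _; rewrite mule_ge0// lee_fin ltW//; exact: rate_gt0.
  - apply: measurable_funTS; apply: emeasurable_funM.
      exact: measurable_before_time.
    by apply/measurable_EFinP; exact: measurable_rate_time.
  - apply: emeasurable_funD => //; apply: emeasurable_funM => //.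
    exact: emeasurable_sum.
  - move=> t _; rewrite before_conf /few/= conf_setT lte_fin ltr_nat.
    have sum_ge0 : 0 <= \sum_(x <- s) (young x * past g (t - x))%:E.
      by apply: sume_ge0 => x _.
    case: ltnP => [tk|_]; last first.
      by rewrite mul0e adde_ge0// ?mule_ge0// lee_fin ?ltW.
    rewrite mul1e /rate EFinD EFinM leeD2l// lee_wpmul2l// excitation_conf//.
    rewrite -sumEFin; apply: lee_sum => x _; rewrite lee_fin /young.
    have [xt|tx] := ltP x t; last by rewrite past_le0 ?mulr0// subr_le0.
    rewrite (_ : (_ < k)%N = true) ?mul1r//; apply: leq_ltn_trans tk.
    rewrite !size_filter; apply: sub_count => y /= yx; exact: lt_trans xt.
rewrite ge0_integralD//; last 3 first.
- by move=> t _; rewrite lee_fin ltW.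
- by move=> t _; rewrite mule_ge0// sume_ge0.
- by apply: emeasurable_funM => //; exact: emeasurable_sum.
rewrite integral_cst//= lebesgue_measure_itv/= lte_fin.
apply: leeD.
  have Ts0 : (0 <= mu * (T - s0))%R by rewrite mulr_ge0 ?subr_ge0// ltW.
  by case: ifP => _; rewrite ?mule0 -?EFinB -?EFinM lee_fin.
rewrite ge0_integralZl_EFin//; last 2 first.
- by move=> t _; rewrite sume_ge0.
- exact: emeasurable_sum.
rewrite lee_wpmul2l// ge0_integral_sum//.
rewrite conf_setT -EFin_min -natr_min minEnat.
rewrite -(sum_rank_lt _ ss) natr_sum -sumEFin; apply: lee_sum => x _.
under eq_integral do rewrite EFinM.
rewrite ge0_integralZl_EFin//.
- rewrite -[leRHS]mule1 lee_wpmul2l ?lee_fin//; exact: integral_past_le.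
- by move=> t _; rewrite lee_fin past_ge0.
- exact: mpx.
Qed.

Let mX : measurable_fun setT X. Proof. by case: X_intensity. Qed.

Let mcount : measurable_fun setT (fun w => X w [set: R]).
Proof. exact: measurable_comp_eval. Qed.

Let mean_few_le k : \int[P]_w mine (X w [set: R]) k%:R%:E <=
  (mu * (T - s0) / (1 - rho))%:E.
Proof.
have [_ _ /(_ (few k) (measurable_few k) (few_ge0 k))] := X_intensity.
under eq_integral do rewrite few_jumps.
set m := \int[P]_w mine _ _ => mE.
have mmin : measurable_fun setT (fun w => mine (X w [set: R]) k%:R%:E).
  exact: measurable_mine.
have min_ge0 w : 0 <= mine (X w [set: R]) k%:R%:E.
  by rewrite le_min measure_ge0 lee_fin/=.
have m_fin : m \is a fin_num.
  apply: (bounded_mean_fin_num P mmin min_ge0 (C := k%:R)) => w.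
  by rewrite ge_min lexx orbT.
have m_le : m <= (mu * (T - s0))%:E + rho%:E * m.
  rewrite [leLHS]mE.
  apply: (@le_trans _ _ (\int[P]_w ((mu * (T - s0))%:E +
      rho%:E * mine (X w [set: R]) k%:R%:E))).
    apply: ge0_le_integral => //.
    - move=> w _; apply: integral_ge0 => t _.
      by rewrite mule_ge0// lee_fin ltW//; exact: rate_gt0.
    - exact: (measurable_compensator mu_gt0 rho_ge0 g_shape X_intensity
        (measurable_few k) (few_ge0 k)).
    - by apply: emeasurable_funD => //; exact: emeasurable_funM.
  rewrite ge0_integralD//; last 3 first.
  - by move=> w _; rewrite lee_fin mulr_ge0 ?subr_ge0// ltW.
  - by move=> w _; rewrite mule_ge0.
  - exact: emeasurable_funM.
  rewrite (integral_cst P measurableT) [X in _ * X]probability_setT mule1.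
  by rewrite ge0_integralZl_EFin.
move: m_le; rewrite -(fineK m_fin) -EFinM -EFinD !lee_fin => m_le.
by rewrite ler_pdivlMr ?subr_gt0//; lra.
Qed.

Lemma mean_number_le :
  \int[P]_w X w [set: R] <= (mu * (T - s0) / (1 - rho))%:E.
Proof.
have min_cvg w : X w [set: R] = limn (fun k => mine (X w [set: R]) k%:R%:E).
  by apply/esym/cvg_lim => //; exact: mine_natr_cvg.
have min_ge0 w k : 0 <= mine (X w [set: R]) k%:R%:E.
  by rewrite le_min measure_ge0 lee_fin/=.
have min_nd w : {homo (fun k => mine (X w [set: R]) k%:R%:E) :
    k l / (k <= l)%N >-> k <= l}.
  by move=> k l kl; rewrite le_min !ge_min lexx/= lee_fin ler_nat kl orbT.
have mmin k : measurable_fun setT (fun w => mine (X w [set: R]) k%:R%:E).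
  exact: measurable_mine.
rewrite (eq_integral _ _ (fun w _ => min_cvg w)).
rewrite (@monotone_convergence _ _ _ P setT measurableT
  (fun k w => mine (X w [set: R]) k%:R%:E) mmin); last 2 first.
- by move=> k w _; exact: min_ge0.
- by move=> w _; exact: min_nd.
apply: lime_le; last by apply: nearW => k; exact: mean_few_le.
apply: ereal_nondecreasing_is_cvgn => k l kl; apply: ge0_le_integral => // w _.
exact: min_nd.
Qed.

End mean_number_of_points.

(** * Entropy bound from the total excitation *)

Section excitation_budget.
Local Open Scope ereal_scope.
Context d (Omega : measurableType d) (R : realType) (P : probability Omega R).
Variables (mu rho0 rho1 s0 T : R) (g : R -> R) (X : Omega -> config R).
Hypotheses (mu_gt0 : (0 < mu)%R) (rho1_gt0 : (0 < rho1)%R).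
Hypotheses (rho10 : (rho1 <= rho0)%R) (rho0_lt1 : (rho0 < 1)%R).
Hypothesis g_shape : kernel_shape g.
Hypothesis s0T : (s0 <= T)%R.
Hypothesis X_intensity : has_intensity P s0 T X (rate mu g rho0).
Local Notation leb := (@lebesgue_measure R).
Local Notation lam0 := (rate mu g rho0).
Local Notation lam1 := (rate mu g rho1).
Local Notation dens := (dens mu s0 T g).

Let rho1_ge0 : (0 <= rho1)%R. Proof. exact: ltW. Qed.
Let rho0_ge0 : (0 <= rho0)%R. Proof. exact: le_trans rho10. Qed.
Let mX : measurable_fun setT X. Proof. by case: X_intensity. Qed.

Let total w := \int[leb]_(t in `]s0, T[) (excitation g (X w) t)%:E.

Let total_le w : total w <= X w [set: R].
Proof.
have [_ /(_ w)[s [_ _ XE]] _] := X_intensity.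
rewrite /total XE conf_setT; exact: integral_excitation_le.
Qed.

Let total_ge0 w : 0 <= total w.
Proof. by apply: integral_ge0 => t _; rewrite lee_fin excitation_ge0. Qed.

Let mexcitation : measurable_fun setT
  (fun z : Omega * measurableTypeR R => excitation g (X z.1) z.2).
Proof.
apply: measurable_excitation => //.
by apply: measurableT_comp => //; exact: measurable_fst.
Qed.

Let mtotal : measurable_fun setT total.
Proof.
apply: (measurable_itv_integral (h := fun z => (excitation g (X z.1) z.2)%:E)) => //.
- by move=> z; rewrite lee_fin excitation_ge0.
- exact/measurable_EFinP.
Qed.

Let total_fin w : total w \is a fin_num.
Proof.
have [_ /(_ w)[s [_ _ XE]] _] := X_intensity.
rewrite ge0_fin_numE//; apply: le_lt_trans (total_le w) _.
by rewrite XE conf_setT ltry.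
Qed.

Lemma mean_total_le :
  \int[P]_w total w <= (mu * (T - s0) / (1 - rho0))%:E.
Proof.
apply: le_trans (mean_number_le mu_gt0 rho0_ge0 rho0_lt1 g_shape s0T X_intensity).
apply: ge0_le_integral => //; exact: measurable_comp_eval.
Qed.

(* What log x <= x - 1 yields at x = lambda_0 / lambda_1. *)
Let gap (z : config R * R) : \bar R := (lam0 z.1 z.2 / lam1 z.1 z.2 - 1)%:E.

Let lam1_gt0 xi t : (0 < lam1 xi t)%R. Proof. exact: rate_gt0. Qed.

Let gapE xi t : (lam0 xi t / lam1 xi t - 1 =
  (rho0 - rho1) * excitation g xi t / lam1 xi t)%R.
Proof.
have := lam1_gt0 xi t; rewrite /rate; set S := excitation g xi t => h.
by field; rewrite gt_eqF.
Qed.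

Let gap_ge0 z : 0 <= gap z.
Proof.
rewrite lee_fin gapE divr_ge0 ?(ltW (lam1_gt0 _ _))// mulr_ge0 ?subr_ge0//.
exact: excitation_ge0.
Qed.

Let mgap : measurable_fun setT gap.
Proof.
apply/measurable_EFinP; apply: measurable_funB => //.
apply: measurable_funM; first exact: measurable_rate.
by apply: measurable_inv_gt0 => [z|]; [exact: lam1_gt0|exact: measurable_rate].
Qed.

Let V1 w := \int[X w]_t gap (before t (X w), t).

Let V2 w : \bar R :=
  (prim s0 (lam0 (X w)) T - prim s0 (lam1 (X w)) T)%:E.

Let primE rho w : (0 <= rho)%R ->
  (prim s0 (rate mu g rho (X w)) T = mu * (T - s0) + rho * fine (total w))%R.
Proof.
move=> rho_ge0; rewrite /prim /Rintegral.
under eq_integral do rewrite /rate EFinD EFinM.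
have mE : measurable_fun `]s0, T[ (fun t => (excitation g (X w) t)%:E).
  apply/measurable_EFinP/measurable_funTS.
  by apply: (@measurable_excitation _ g g_shape _ _ (fun=> X w) id).
rewrite ge0_integralD//; last 3 first.
- by move=> t _; rewrite lee_fin ltW.
- by move=> t _; rewrite -EFinM lee_fin mulr_ge0// excitation_ge0.
- exact: emeasurable_funM.
rewrite ge0_integralZl_EFin//; last first.
  by move=> t _; rewrite lee_fin excitation_ge0.
rewrite integral_cst//= lebesgue_measure_itv/= lte_fin.
rewrite -/(total w) -[X in rho%:E * X](fineK (total_fin w)).
by case: ltP s0T => [_ _|Ts s0T']; rewrite -?EFinB -?EFinM -?EFinD//=
  ?mule0 ?add0e//=; rewrite (_ : T = s0) ?subrr ?mulr0 ?add0r//; lra.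
Qed.

Let V2E w : V2 w = (rho0 - rho1)%:E * total w.
Proof.
rewrite /V2 !primE// -[total w]fineK// -EFinM; congr EFin.
by rewrite /=; ring.
Qed.

Let C := ((rho0 - rho1) ^+ 2 / rho1 * (mu * (T - s0) / (1 - rho0)))%R.

Let mean_V2 : \int[P]_w V2 w = (rho0 - rho1)%:E * \int[P]_w total w.
Proof.
under eq_integral do rewrite V2E.
by rewrite ge0_integralZl_EFin// subr_ge0.
Qed.

Let mean_V1 : \int[P]_w V1 w <= \int[P]_w V2 w + C%:E.
Proof.
have [_ _ /(_ gap mgap gap_ge0) ->] := X_intensity.
(* lambda_0 / lambda_1 <= rho0 / rho1, since both intensities have the same
   baseline and rho1 <= rho0. *)
pose kappa := ((rho0 - rho1) * (rho0 / rho1))%R.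
have kappa_ge0 : (0 <= kappa)%R by rewrite mulr_ge0 ?subr_ge0// divr_ge0.
apply: (@le_trans _ _ (\int[P]_w (kappa%:E * total w))).
  apply: ge0_le_integral => //.
  - move=> w _; apply: integral_ge0 => t _; rewrite mule_ge0// lee_fin ltW//.
    exact: rate_gt0.
  - exact: (measurable_compensator mu_gt0 rho0_ge0 g_shape X_intensity).
  - exact: emeasurable_funM.
  move=> w _; rewrite /total -ge0_integralZl_EFin//; last 2 first.
  - by move=> t _; rewrite lee_fin excitation_ge0.
  - apply/measurable_EFinP/measurable_funTS.
    by apply: (@measurable_excitation _ g g_shape _ _ (fun=> X w) id).
  have [_ /(_ w)[s [_ _ ->]] _] := X_intensity.
  apply: ge0_le_integral => //.
  - move=> t _; rewrite mule_ge0// lee_fin ltW//; exact: rate_gt0.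
  - apply: measurable_funTS; apply: emeasurable_funM.
      exact: measurable_before_time.
    by apply/measurable_EFinP; exact: measurable_rate_time.
  - apply: emeasurable_funM => //; apply/measurable_EFinP/measurable_funTS.
    by apply: (@measurable_excitation _ g g_shape _ _ (fun=> conf s) id).
  move=> t _; rewrite before_conf /gap/= !rate_before//.
  rewrite -!EFinM lee_fin gapE /kappa.
  have := excitation_ge0 g_shape (conf s) t; have := lam1_gt0 (conf s) t.
  rewrite /rate; set S := excitation g (conf s) t => l1 S0.
  have -> : ((rho0 - rho1) * S / (mu + rho1 * S) * (mu + rho0 * S) =
    (rho0 - rho1) * ((mu + rho0 * S) / (mu + rho1 * S)) * S)%R.
    by field; rewrite gt_eqF.
  rewrite ler_wpM2r// ler_wpM2l ?subr_ge0// ler_pdivrMr// mulrAC ler_pdivlMr//.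
  have : (0 <= mu * (rho0 - rho1))%R by rewrite mulr_ge0 ?subr_ge0// ltW.
  by lra.
rewrite ge0_integralZl_EFin// mean_V2.
have := mean_total_le; have : 0 <= \int[P]_w total w by exact: integral_ge0.
case: (\int[P]_w total w) => // m m0; rewrite lee_fin => hm.
rewrite -!EFinM -EFinD lee_fin /C.
have -> : (kappa * m = (rho0 - rho1) * m + (rho0 - rho1) ^+ 2 / rho1 * m)%R.
  by rewrite /kappa; field; rewrite gt_eqF.
by rewrite lerD2l ler_wpM2l// divr_ge0// sqr_ge0.
Qed.

Let log_L_le w : (- ln (dens rho1 (X w) / dens rho0 (X w)))%:E + V2 w <= V1 w.
Proof.
rewrite /V1 /V2.
have [_ /(_ w)[s [_ _ ->]] _] := X_intensity.
rewrite integral_before_conf//.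
under eq_bigr do rewrite /gap/= !rate_before//.
rewrite sumEFin -EFinD lee_fin.
have lndens rho : (0 <= rho)%R -> (ln (dens rho (conf s)) =
    \sum_(x <- s) ln (rate mu g rho (conf s) x / mu) -
    prim s0 (rate mu g rho (conf s)) T)%R.
  move=> rho_ge0; rewrite /dens lnM ?posrE ?expR_gt0 ?rate_prod_gt0// expRK.
  congr (_ - _)%R; rewrite rate_prod_conf//.
  apply: expR_inj; rewrite expR_sum lnK; last first.
    rewrite posrE; apply: prodr_gt0 => x _; rewrite divr_gt0//; exact: rate_gt0.
  by apply: eq_bigr => x _; rewrite lnK// posrE divr_gt0//; exact: rate_gt0.
rewrite ln_div ?posrE ?dens_gt0// !lndens//.
set p1 := prim _ _ _; set p0 := prim _ _ _.
set a1 := (\sum_(x <- s) _)%R; set a0 := (\sum_(x <- s) _)%R.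
have -> : (- (a1 - p1 - (a0 - p0)) + (p0 - p1) = a0 - a1)%R by ring.
rewrite /a0 /a1 -sumrB; apply: ler_sum => x _.
have l0 : (0 < lam0 (conf s) x)%R by exact: rate_gt0.
have l1 := lam1_gt0 (conf s) x.
rewrite -ln_div ?posrE ?divr_gt0//.
have -> : (lam0 (conf s) x / mu / (lam1 (conf s) x / mu) =
  1 + (lam0 (conf s) x / lam1 (conf s) x - 1))%R.
  by field; rewrite !gt_eqF.
apply: le_ln1Dx; rewrite ltrBrDr addrC subrr divr_gt0//.
Qed.

(** The log-likelihood ratio is bounded by V1 - V2, with V1 the sum of [gap]
over the points and V2 the difference of the compensators; [mean_V1] bounds
E V1 - E V2 by the total excitation, itself at most the number of points. *)
Lemma KL_le_excitation d' (U : measurableType d') (Q : probability U R)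
    (Z : {mfun Omega >-> U}) :
  (forall h : U -> \bar R, measurable_fun setT h -> (forall y, 0 <= h y) ->
    \int[Q]_y h y =
    \int[P]_w (h (Z w) * (dens rho1 (X w) / dens rho0 (X w))%:E)) ->
  KL (distribution P Z) Q <= C%:E.
Proof.
move=> change_law.
have mdens rho : (0 <= rho)%R -> measurable_fun setT (fun w => dens rho (X w)).
  by move=> rho_ge0; apply: (measurableT_comp (measurable_dens _ _ _ _ rho_ge0)).
apply: (@KL_le_log_bound _ _ _ _ _ P Q Z (fun w => (dens rho1 (X w) / dens rho0 (X w))%R)
  _ _ _ V1 V2) => //.
- by move=> w; rewrite divr_gt0// dens_gt0.
- apply: measurable_funM; first exact: mdens.
  by apply: measurable_inv_gt0 => [w|]; [exact: dens_gt0|exact: mdens].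
- exact: (measurable_jump_integral X_intensity).
- apply/measurable_EFinP; apply: measurable_funB; exact: measurable_prim_rate.
- by move=> w; apply: integral_ge0 => t _; exact: gap_ge0.
- by move=> w; rewrite V2E mule_ge0// lee_fin subr_ge0.
- rewrite mean_V2.
  have := mean_total_le; have : 0 <= \int[P]_w total w by exact: integral_ge0.
  by case: (\int[P]_w total w) => // m _ _; rewrite -EFinM ltry.
Qed.

End excitation_budget.

(** * Observation on a closed interval *)

Section observation_window.
Local Open Scope ereal_scope.
Context d (Omega : measurableType d) (R : realType) (P : probability Omega R).
Variables (N : R.-ker Omega ~> measurableTypeR R).
Variables (s0 S T : R) (X : Omega -> config R).
Hypothesis (ST : (S < T)%R).
Hypothesis N_start : forall w, N w `]-oo, s0]%classic = 0.
Hypothesis mX : measurable_fun setT X.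
Hypothesis XN : {ae P, forall w, forall B, measurable B ->
  X w B = restriction N (measurable_itv `]s0, T[) w B}.

Definition window (a b : R) (xi : config R) : config R :=
  mrestr xi (measurable_itv `[a, b]).

Lemma measurable_window a b : measurable_fun setT (window a b).
Proof.
apply: measurable_config => B mB.
by apply: measurable_eval; exact: measurableI.
Qed.

(** Modifying the process on the open window ]s0, T[ does not change its law
on [0, S], since S < T and there are no points up to s0.  The latter also
covers s0 = 0, where 0 belongs to the observation interval only. *)
Lemma mean_window (h : config R -> \bar R) (k : Omega -> R) :
  measurable_fun setT h -> (forall xi, 0 <= h xi) ->
  measurable_fun setT k -> (forall w, (0 <= k w)%R) ->
  \int[P]_w (h (restriction N (measurable_itv `[0%R, S]) w) * (k w)%:E) =
  \int[P]_w (h (window 0 S (X w)) * (k w)%:E).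
Proof.
move=> mh h0 mk k0; apply: ge0_ae_eq_integral => //.
- apply: emeasurable_funM; last exact/measurable_EFinP.
  by apply: (measurableT_comp mh); exact: measurable_funP.
- apply: emeasurable_funM; last exact/measurable_EFinP.
  apply: (measurableT_comp mh).
  by apply: measurableT_comp => //; exact: measurable_window.
- by move=> w _; rewrite mule_ge0// lee_fin.
- by move=> w _; rewrite mule_ge0// lee_fin.
apply: filterS XN => w XNw _; congr (_ * _).
apply: measurable_config_ext => // B mB.
rewrite /window /= /mrestr XNw; last exact: measurableI.
rewrite /restriction /= /mrestr.
apply/eqP; rewrite eq_le; apply/andP; split; last first.
  by apply: le_measure; rewrite ?inE//; repeat apply: measurableI.
have E : B `&` `[0%R, S] = (B `&` `[0%R, S] `&` `]s0, T[) `|`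
    (B `&` `[0%R, S] `&` `]-oo, s0]) :> set R.
  rewrite -setIUr; apply/esym/setIidl => x [_]; rewrite /= !in_itv/= => /andP[_ xS].
  by rewrite (le_lt_trans xS ST) andbT; case: leP; [right|left].
have before_start : N w (B `&` `[0%R, S] `&` `]-oo, s0]) = 0.
  apply: (subset_measure0 (mu := N w) _ _ _ (N_start w)) => //.
  by repeat apply: measurableI.
rewrite [X in N w X <= _]E.
apply: (le_trans (measureU2 (N w) _ _)); try by repeat apply: measurableI.
by rewrite [X in _ + X](_ : _ = 0)// adde0.
Qed.

End observation_window.

Theorem theorem2p2 (R : realType) (mu T c delta rho0 rho1 : R) (g : R -> R)
    (d0 d1 : measure_display)
    (Omega0 : measurableType d0) (Omega1 : measurableType d1)
    (P0 : probability Omega0 R) (P1 : probability Omega1 R)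
    (N0 : R.-ker Omega0 ~> measurableTypeR R)
    (N1 : R.-ker Omega1 ~> measurableTypeR R)
    (mu_gt0 : 0 < mu) (T_gt0 : 0 < T) (c_ge0 : 0 <= c) (delta_gt0 : 0 < delta)
    (rho0_lt1 : rho0 < 1) (rho1_lt1 : rho1 < 1)
    (rho01 : 1 - rho1 = (1 + delta) * (1 - rho0)) (rho1_gt0 : 0 < rho1)
    (g_shape : kernel_shape g)
    (hawkes0 : linear_hawkes mu rho0 g (- (c * T)) P0 N0)
    (hawkes1 : linear_hawkes mu rho1 g (- (c * T)) P1 N1) :
  (KL (law_on P0 N0 `[0%R, T]) (law_on P1 N1 `[0%R, T])
   <= (delta ^+ 2 * (1 + c) / (rho0 * rho1) * (T * mu * (1 - rho0)))%:E)%E.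
Proof.
have gap : rho0 - rho1 = delta * (1 - rho0) by lra.
have rho10 : rho1 <= rho0 by rewrite -subr_ge0 gap mulr_ge0 ?subr_ge0// ltW.
have rho0_gt0 : 0 < rho0 by exact: lt_le_trans rho10.
set s0 := - (c * T) in hawkes0 hawkes1.
(* The denominator rho0 of the bound pays for this longer window. *)
pose T' := s0 + (T - s0) / rho0.
have Ts0 : 0 < T - s0 by rewrite /s0 opprK ltr_pwDl// mulr_ge0// ltW.
have TT' : T < T'.
  by rewrite /T' -ltrBlDl ltr_pdivlMr// -[ltRHS]mulr1 ltr_pM2l.
have s0T' : s0 <= T' by lra.
have [X0 [X0_intensity X0N]] := hawkes_modification T' mu_gt0 (ltW rho0_gt0) g_shape hawkes0.
have [X1 [X1_intensity X1N]] := hawkes_modification T' mu_gt0 (ltW rho1_gt0) g_shape hawkes1.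
have [[_ start0 _] _] := hawkes0; have [[_ start1 _] _] := hawkes1.
have [mX0 _ _] := X0_intensity; have [mX1 _ _] := X1_intensity.
have -> : delta ^+ 2 * (1 + c) / (rho0 * rho1) * (T * mu * (1 - rho0)) =
    (rho0 - rho1) ^+ 2 / rho1 * (mu * (T' - s0) / (1 - rho0)).
  rewrite gap /T' /s0; field; rewrite !gt_eqF ?subr_gt0//.
apply: (KL_le_excitation mu_gt0 rho1_gt0 rho10 rho0_lt1 g_shape s0T' X0_intensity
  (Q := law_on P1 N1 `[0%R, T]) (Z := restriction N0 (measurable_itv `[0%R, T]))).
move=> h mh h0.
have mdens rho : 0 <= rho -> measurable_fun setT (fun w => dens mu s0 T' g rho (X0 w)).
  by move=> rho_ge0; apply: (measurableT_comp (measurable_dens s0 T' mu_gt0 g_shape rho_ge0)).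
rewrite (mean_window TT' start0 mX0 X0N mh h0); last 2 first.
- apply: measurable_funM; first exact/mdens/ltW.
  apply: measurable_inv_gt0 => [w|]; first exact: dens_gt0.
  exact/mdens/ltW.
- by move=> w; rewrite ltW// divr_gt0// dens_gt0.
have mhw : measurable_fun setT (h \o window 0 T).
  by apply: measurableT_comp => //; exact: measurable_window.
rewrite -(change_of_law mu_gt0 (ltW rho0_gt0) (ltW rho1_gt0) g_shape s0T'
  X0_intensity X1_intensity mhw (fun xi => h0 _)).
rewrite ge0_integral_distribution//.
have := mean_window TT' start1 mX1 X1N mh h0 (k := fun=> 1).
under eq_integral do rewrite mule1.
under [in RHS]eq_integral do rewrite mule1.
by apply.
Qed.
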